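(* Let $(\Omega,\mathcal F,\mu,\{\mathcal F_n\}_{n\ge 0})$ be a filtered probability space, let $1<p<\infty$, let $p'=p/(p-1)$, and let $u,w$ be weights with $\sigma=w^{-\frac1{p-1}}\in L^1$. There is a constant $C$ depending only on $p$ (not on the weights) such that: (1) If $(u,w)\in B_p$, then $\|M\|_{L^p(w)\to L^p(u)}\le C\,[u,w]_{B_p}^{\frac1p}$. (2) If $(u,w)\in A_p$ and $\sigma\in A^*_\infty$, then $\|M\|_{L^p(w)\to L^p(u)}\le C\,[u,w]_{A_p}^{\frac1p}\,[\sigma]_{A^*_\infty}^{\frac1p}$. (3) If $w\in A_p$, then $\|M\|_{L^p(w)\to L^p(w)}\le C\,[\sigma]_{(A_{p'})^{\frac1{p'}}(A^*_\infty)^{\frac1p}}\,\big(1+\log_2[w]_{A_p}\big)^{\frac1p}$.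
   Context: Filtered probability space: $(\Omega,\mathcal F,\mu)$ is a complete probability space, $\{\mathcal F_n\}_{n\ge0}$ is an increasing sequence of sub-$\sigma$-algebras of $\mathcal F$, each $(\Omega,\mathcal F_n,\mu)$ is complete, and $\mathcal F$ is the $\sigma$-algebra generated by $\bigcup_n\mathcal F_n$. Notation: $g_n=\mathbb E_n(g)=\mathbb E(g\mid\mathcal F_n)$. Doob's maximal operator is $Mf=\sup_{n\ge0}|f_n|$, and the tail maximal operators are ${}^*M_nf=\sup_{m\ge n}|f_m|$. A weight is a positive random variable in $L^1(\mu)$; $\|f\|_{L^p(w)}=(\int_\Omega|f|^pw\,d\mu)^{1/p}$. $\|M\|_{L^p(w)\to L^p(u)}$ is the smallest constant $C_3$ with $\|Mf\|_{L^p(u)}\le C_3\|f\|_{L^p(w)}$ for all $f\in L^p(w)$ (note $L^p(w)\subset L^1(\mu)$ since $\sigma\in L^1$). Weight conditions (inequalities between random variables hold a.e.): - $[w]_{A_p}=\sup_{n\ge0}\|w_n(\sigma_n)^{p-1}\|_\infty$, and $w\in A_p$ means this is finite. For a pair, $[u,w]_{A_p}=\sup_{n\ge0}\|u_n(\sigma_n)^{p-1}\|_\infty$, and $(u,w)\in A_p$ means this is finite. - $(u,w)\in B_p$ if there is $C>0$ with $\mathbb E_n(u)\,\mathbb E_n(\sigma)^p\le C\exp\big(\mathbb E_n(\log\sigma)\big)$ for all $n\ge0$; $[u,w]_{B_p}$ is the smallest such $C$. (Here $\mathbb E_n(\log\sigma)\in[-\infty,\infty)$ is well defined since $\sigma\in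 L^1$.) - A weight $\rho$ satisfies $\rho\in A^*_\infty$ if there is $C>0$ with $\mathbb E_n({}^*M_n\rho)\le C\rho_n$ for all $n\ge0$; $[\rho]_{A^*_\infty}$ is the smallest such $C$. - $[\sigma]_{(A_{p'})^{\frac1{p'}}(A^*_\infty)^{\frac1p}}=\sup_{n\ge0}\Big\|\sigma_n^{p-1}\,w_n\,\mathbb E_n\Big(\frac{{}^*M_n\sigma}{\sigma_n}\Big)\Big\|_\infty^{\frac1p}$. *)

(* Defs.v *)
From HB Require Import structures.
From mathcomp Require Export all_boot all_order all_algebra.
From mathcomp Require Export all_classical all_reals all_analysis.
From mathcomp Require Export measurable_realfun ess_sup_inf.

Set Implicit Arguments.
Unset Strict Implicit.
Unset Printing Implicit Defensive.

Import Order.TTheory GRing.Theory Num.Def Num.Theory.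
Import numFieldNormedType.Exports.

Local Open Scope classical_set_scope.
Local Open Scope ring_scope.
Local Open Scope ereal_scope.

Record filtered_probability_space (d : measure_display) (T : measurableType d)
    (R : realType) (mu : probability T R) (F : nat -> set (set T)) : Prop := {
  fps_complete : measure_is_complete mu;
  fps_sigma_algebra : forall n, sigma_algebra [set: T] (F n);
  fps_sub : forall n, F n `<=` measurable;
  fps_increasing : forall m n, (m <= n)%N -> F m `<=` F n;
  fps_complete_n : forall n (N A : set T), F n N -> mu N = 0 -> A `<=` N -> F n A;
  fps_generated : <<s \bigcup_n F n >> = (measurable : set (set T))
}.

Section conditional_expectation.
Context (d : measure_display) (T : measurableType d) (R : realType).
Variables (mu : probability T R) (G : set (set T)).

(* For G a sub-sigma-algebra, this determines g up to a null set as soon as f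
   is measurable and either f >= 0 a.e. or f has an integrable positive part;
   the latter includes integrable f, in which case g is integrable as well. *)
Definition is_cond_exp (f g : T -> \bar R) : Prop :=
  (forall B : set (\bar R), measurable B -> G (g @^-1` B)) /\
  (forall A, G A -> \int[mu]_(x in A) g x = \int[mu]_(x in A) f x).

Definition cond_exp (f : T -> \bar R) : T -> \bar R :=
  xget (cst 0) [set g | is_cond_exp f g].

End conditional_expectation.

Section weights.
Context (d : measure_display) (T : measurableType d) (R : realType).
Variables (mu : probability T R) (F : nat -> set (set T)).

Local Notation E_ n f := (cond_exp mu (F n) f) (only parsing).

Definition doob_maximal (f : T -> R) (x : T) : \bar R :=
  ereal_sup [set `|E_ n (EFin \o f) x| | n in [set: nat]].

Definition tail_maximal (n : nat) (f : T -> R) (x : T) : \bar R :=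
  ereal_sup [set `|E_ m (EFin \o f) x| | m in [set m | (n <= m)%N]].

Definition weight (w : T -> R) : Prop :=
  mu.-integrable [set: T] (EFin \o w) /\ {ae mu, forall x, (0 < w x)%R}.

Variable p : R.

Definition dual_weight (w : T -> R) (x : T) : R := (w x `^ (- (p - 1)^-1))%R.

Definition weighted_norm (w : T -> R) (f : T -> \bar R) : \bar R :=
  (\int[mu]_x (`|f x| `^ p * (w x)%:E)) `^ p^-1.

Definition weighted_Lp (w : T -> R) : set (T -> R) :=
  [set f | measurable_fun [set: T] f /\ weighted_norm w (EFin \o f) < +oo].

(* The norm of the maximal operator from L^p(w) to L^p(u); +oo if unbounded. *)
Definition maximal_norm (w u : T -> R) : \bar R :=
  ereal_inf [set C%:E | C in [set C : R | (0 <= C)%R /\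
    forall f, weighted_Lp w f ->
      weighted_norm u (doob_maximal f) <= C%:E * weighted_norm w (EFin \o f)]].

Definition Ap_const (u w : T -> R) : \bar R :=
  let sigma := dual_weight w in
  ereal_sup [set Lnorm mu +oo (fun x =>
      E_ n (EFin \o u) x * E_ n (EFin \o sigma) x `^ (p - 1))
    | n in [set: nat]].

Definition in_Ap (u w : T -> R) : Prop := Ap_const u w < +oo.

Definition Bp_bound (u w : T -> R) (C : R) : Prop :=
  (0 < C)%R /\ forall n, {ae mu, forall x,
    E_ n (EFin \o u) x * E_ n (EFin \o dual_weight w) x `^ p <=
    C%:E * expeR (E_ n (fun y => (ln (dual_weight w y))%:E) x)}.

Definition in_Bp (u w : T -> R) : Prop := exists C, Bp_bound u w C.

Definition Bp_const (u w : T -> R) : \bar R :=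
  ereal_inf [set C%:E | C in Bp_bound u w].

Definition Ainfty_bound (rho : T -> R) (C : R) : Prop :=
  (0 < C)%R /\ forall n, {ae mu, forall x,
    E_ n (tail_maximal n rho) x <= C%:E * E_ n (EFin \o rho) x}.

Definition in_Ainfty (rho : T -> R) : Prop := exists C, Ainfty_bound rho C.

Definition Ainfty_const (rho : T -> R) : \bar R :=
  ereal_inf [set C%:E | C in Ainfty_bound rho].

(* The constant [sigma]_{(A_{p'})^{1/p'} (A^*_infty)^{1/p}}, sigma being the
   dual weight of w. *)
Definition mixed_const (w : T -> R) : \bar R :=
  let sigma := dual_weight w in
  ereal_sup [set Lnorm mu +oo (fun x =>
      E_ n (EFin \o sigma) x `^ (p - 1) * E_ n (EFin \o w) x *
      E_ n (fun y => tail_maximal n sigma y / E_ n (EFin \o sigma) y) x) `^ p^-1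
    | n in [set: nat]].

End weights.

(* Main.v *)
From HB Require Import structures.
Require Import Defs.
From mathcomp Require Import ring lra.
Set Implicit Arguments.
Unset Strict Implicit.
Unset Printing Implicit Defensive.
Import Order.TTheory GRing.Theory Num.Def Num.Theory.
Import numFieldNormedType.Exports.
Local Open Scope classical_set_scope.
Local Open Scope ring_scope.
Local Open Scope ereal_scope.

(* Write [phi = |f|], [sigma] for the dual weight, and [phi_n], [s_n], [u_n] for
   conditional expectations. Recording the times at which [phi_n] more than
   doubles its last recorded value gives a sparse family of events [S_n] with
   [(sup phi_n)^p <= 2^p sum_n 1_{S_n} phi_n^p], and sparseness yields
   [sum_n E(1_{S_n} Z_n) <= 2 E(sup_n Z_n)] for adapted [Z_n >= 0] vanishing
   with [phi_n]. Since [phi_n^p u_n = x_n^p s_n (u_n s_n^(p-1))] with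
   [x_n = phi_n / s_n], it remains to bound [E(sup_n Z_n)].
   - Under A_p and A_infty^*, [Z_n = x_n^p s_n]: summing by parts along the
     running maximum of [x_n^p] replaces [s_n] by the tail maximal function of
     [sigma], and the weighted Doob inequality for [x_n] concludes. The third
     bound does this on each slice [2^j <= w_n s_n^(p-1) < 2^(j+1)].
   - Under B_p, Jensen gives [exp (E_n (ln sigma)) <= E_n(sigma^(1/2))^2], so
     [Z_n <= E_n(h)^2] with [h^2 = sigma sup_n x_n^p], and Doob's inequality is
     applied first in L^2 and then in its weighted form.
   Doob's inequality itself follows from summation by parts: with [m_k] the
   running maximum of [x_k],
   [(m_k^p - m_(k-1)^p) s_k <= p' (m_k^(p-1) - m_(k-1)^(p-1)) phi_k]. *)

(** The maximal function is first turned into a sum because [u] is not adapted: inside a supremum it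
    cannot be conditioned, whereas $1_{S_n}\phi_n^p$ is known at time $n$ and lets [u] be replaced
    by $u_n$. The quotient $x_n$ is the conditional expectation of $\phi/\sigma$ for the measure
    $\sigma\,d\mu$, and $\phi^p w=(\phi/\sigma)^p\sigma$. So the weighted Doob inequality is the
    ordinary one for that measure, and its constant sees only $p$. The remaining obstacle is that
    $\sup_n x_n^p s_n$ carries $s_n$ in place of $\sigma$. Under $A^*_\infty$ the tail maximal
    function removes it. Under $B_p$, Jensen with exponent 1 would only lead back to $s_n$; an
    exponent below 1 leaves room for a Doob inequality with exponent above 1, and 1/2 makes that an
    unweighted $L^2$ estimate. In the third bound, slice $j$ has A_p factor at most $2^{j+1}$ and
    tail constant $2^{-j}m^p$, with $m$ the mixed constant. Every slice costs $2m^p$, and the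
    logarithm counts slices. *)

Section integral_sup.
Context (d : measure_display) (T : measurableType d) (R : realType).
Variable mu : {measure set T -> \bar R}.

(** Monotone convergence in the form that lets the maximal estimates below be proved at finite
    horizons first. *)
Lemma ge0_le_integral_sup (g : nat -> T -> \bar R) (f : T -> \bar R)
    (B : \bar R) :
  (forall n, measurable_fun [set: T] (g n)) -> (forall n x, 0 <= g n x) ->
  (forall x, nondecreasing_seq (g^~ x)) -> (forall n, \int[mu]_x g n x <= B) ->
  measurable_fun [set: T] f -> (forall x, 0 <= f x) ->
  {ae mu, forall x, f x <= ereal_sup (range (g^~ x))} -> \int[mu]_x f x <= B.
Proof.
move=> mg g0 ndg gB mf f0 fg.
have gE x : ereal_sup (range (g^~ x)) = limn (g^~ x).
  by apply/esym/cvg_lim => //; exact: ereal_nondecreasing_cvgn (ndg x).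
have mlim : measurable_fun [set: T] (fun x => limn (g^~ x)).
  apply: (emeasurable_fun_cvg g) => // x _.
  rewrite -gE; exact: ereal_nondecreasing_cvgn (ndg x).
have lim0 x : 0 <= limn (g^~ x).
  by rewrite -gE; apply: le_trans (g0 0%N x) _; apply: ereal_sup_ubound; exists 0%N.
apply: (@le_trans _ _ (\int[mu]_x limn (g^~ x))).
  apply: ae_ge0_le_integral => //.
  by apply: filterS fg => x /=; rewrite gE.
rewrite monotone_convergence//.
apply: lime_le.
  apply: ereal_nondecreasing_is_cvgn => m n mn.
  by apply: ge0_le_integral => // x _; exact: ndg.
exact: nearW.
Qed.

End integral_sup.

(** * Testing integral inequalities against functions measurable for a sub-sigma-algebra *)

Section sub_sigma_algebra.
Context (d : measure_display) (T : measurableType d) (R : realType).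
Variables (mu : probability T R) (G : set (set T)).
Hypotheses (sG : sigma_algebra [set: T] G) (subG : G `<=` measurable).

Local Notation TG := (g_sigma_algebraType G).

Lemma measurable_sub_id : measurable_fun [set: T] (id : T -> TG).
Proof.
by move=> _ B; rewrite measurable_g_measurableTypeE// setTI => /subG.
Qed.

Lemma sub_measurable_fun d' (U : measurableType d') (f : T -> U) :
  measurable_fun [set: TG] (f : TG -> U) -> measurable_fun [set: T] f.
Proof. by move=> mf; exact: (measurableT_comp mf measurable_sub_id). Qed.

Lemma sub_measurable_funP d' (U : measurableType d') (f : T -> U) :
  measurable_fun [set: TG] (f : TG -> U) <->
  (forall B, measurable B -> G (f @^-1` B)).
Proof.
split=> [mf B mB|mf _ B mB].
  by have := mf measurableT B mB; rewrite setTI measurable_g_measurableTypeE.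
by rewrite setTI measurable_g_measurableTypeE//; exact: mf.
Qed.

Import HBNNSimple.

(** The level sets of a simple function on [TG] belong to [G], so the hypothesis applies on each of
    them, and the pieces add up with nonnegative coefficients. *)
Lemma le_integralM_nnsfun (a b : T -> \bar R) (h : {nnsfun TG >-> R}) :
  measurable_fun [set: T] a -> measurable_fun [set: T] b ->
  (forall x, 0 <= a x) -> (forall x, 0 <= b x) ->
  (forall A, G A -> \int[mu]_(x in A) a x <= \int[mu]_(x in A) b x) ->
  \int[mu]_x ((h x)%:E * a x) <= \int[mu]_x ((h x)%:E * b x).
Proof.
move=> ma mb a0 b0 ab.
have mh r : measurable (h @^-1` [set r] : set T).
  apply: subG; rewrite -[X in X _](measurable_g_measurableTypeE sG).
  by rewrite -[X in measurable X]setTI; exact: (measurable_funP h).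
have hE (c : T -> \bar R) : measurable_fun [set: T] c -> (forall x, 0 <= c x) ->
    \int[mu]_x ((h x)%:E * c x) =
    \sum_(y \in range h) (y%:E * \int[mu]_(x in h @^-1` [set y]) c x).
  move=> mc c0.
  transitivity (\int[mu]_x (\sum_(y \in range h)
      (y * \1_(h @^-1` [set y]) x)%:E * c x)).
    apply: eq_integral => x _; rewrite -ge0_mule_fsuml => [|y]; last first.
      exact: nnfun_muleindic_ge0.
    by rewrite fsumEFin//; congr (_%:E * _); exact: (fimfunE h (x : TG)).
  rewrite ge0_integral_fsum//; last 2 first.
  - move=> y; apply: emeasurable_funM => //; apply/measurable_EFinP.
    by apply: measurable_funM => //; exact: measurable_indic.
  - by move=> y x _; rewrite mule_ge0// nnfun_muleindic_ge0.
  apply: eq_fsbigr => r rh.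
  rewrite [in RHS]integral_mkcond epatch_indic.
  under eq_integral do rewrite EFinM -muleA.
  rewrite ge0_integralZl//.
  - by congr (_ * _); apply: eq_integral => x _; rewrite muleC.
  - apply: emeasurable_funM => //; apply/measurable_EFinP.
    exact: measurable_indic.
  - by move=> x _; rewrite mule_ge0// lee_fin.
  - by move: rh; rewrite inE => -[t _ <-]; rewrite lee_fin.
rewrite !hE//; apply: lee_fsum => // y [t _ <-].
apply: lee_wpmul2l; first by rewrite lee_fin.
apply: ab; rewrite -[X in X _](measurable_g_measurableTypeE sG).
by rewrite -[X in measurable X]setTI; exact: (measurable_funP h).
Qed.

(** Simple functions increase to [X]. Infinite values and infinite integrals of [a] and [b] are
    allowed, so that tail maximal functions are covered. *)
Lemma le_integralM_sub (a b : T -> \bar R) (X : T -> R) :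
  measurable_fun [set: T] a -> measurable_fun [set: T] b ->
  (forall x, 0 <= a x) -> (forall x, 0 <= b x) ->
  (forall A, G A -> \int[mu]_(x in A) a x <= \int[mu]_(x in A) b x) ->
  measurable_fun [set: TG] (X : TG -> R) -> (forall x, (0 <= X x)%R) ->
  \int[mu]_x ((X x)%:E * a x) <= \int[mu]_x ((X x)%:E * b x).
Proof.
move=> ma mb a0 b0 ab mX X0.
have mEX : measurable_fun [set: TG] (EFin \o X : TG -> \bar R).
  exact/measurable_EFinP.
pose h := nnsfun_approx (@measurableT _ TG) mEX.
have X0' x : [set: TG] x -> 0 <= (EFin \o X) x by rewrite /= lee_fin.
have hX x : EFin \o h^~ x @ \oo --> (X x)%:E by exact: cvg_nnsfun_approx.
have ndh x : nondecreasing_seq (h^~ x).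
  by move=> m n mn; exact/lefP/nd_nnsfun_approx.
have leh n x : ((h n x)%:E <= (X x)%:E).
  have : {homo (EFin \o h^~ x) : m n / (m <= n)%N >-> m <= n}.
    by move=> i j ij /=; rewrite lee_fin; exact: ndh.
  move=> /ereal_nondecreasing_cvgn/(cvg_unique (@ereal_hausdorff _))/(_ (hX x)) <-.
  by apply: ereal_sup_ubound; exists n.
have mh n : measurable_fun [set: T] (EFin \o (h n : T -> R)).
  apply/measurable_EFinP; apply: (@sub_measurable_fun _ _ (h n : T -> R)).
  exact: measurable_funP.
apply: (@ge0_le_integral_sup _ T _ mu (fun n (x : T) => (h n x)%:E * a x)) => //.
- by move=> n; apply: emeasurable_funM => //; exact: mh.
- by move=> n x; rewrite mule_ge0// lee_fin.
- by move=> x m n mn; rewrite lee_wpmul2r// lee_fin; exact: ndh.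
- move=> n; apply: le_trans (le_integralM_nnsfun _ ma mb a0 b0 ab) _.
  apply: ge0_le_integral => //.
  + by move=> x _; rewrite mule_ge0// lee_fin.
  + by apply: emeasurable_funM => //; exact: mh.
  + apply: emeasurable_funM => //; apply/measurable_EFinP.
    exact: sub_measurable_fun.
  + by move=> x _; rewrite lee_wpmul2r.
- apply: emeasurable_funM => //; apply/measurable_EFinP.
  exact: sub_measurable_fun.
- by move=> x; rewrite mule_ge0// lee_fin.
- apply: aeW => x; have [X_0|X_0] := eqVneq (X x) 0%R.
    rewrite X_0 mul0e; apply: le_trans (_ : 0 <= (h 0%N x)%:E * a x) _.
      by rewrite mule_ge0// lee_fin.
    by apply: ereal_sup_ubound; exists 0%N.
  have /cvg_lim <- // : (fun n => (h n x)%:E * a x) @ \oo --> (X x)%:E * a x.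
    apply: cvgeM; [|exact: hX|exact: cvg_cst].
    by rewrite mule_defE/= !eqe (negbTE X_0)/= ?orbT ?andbF.
  apply: lime_le.
    apply: ereal_nondecreasing_is_cvgn => m n mn.
    by rewrite lee_wpmul2r// lee_fin; exact: ndh.
  by apply: nearW => n; apply: ereal_sup_ubound; exists n.
Qed.

Lemma eq_integralM_sub (a b : T -> \bar R) (X : T -> R) :
  measurable_fun [set: T] a -> measurable_fun [set: T] b ->
  (forall x, 0 <= a x) -> (forall x, 0 <= b x) ->
  (forall A, G A -> \int[mu]_(x in A) a x = \int[mu]_(x in A) b x) ->
  measurable_fun [set: TG] (X : TG -> R) -> (forall x, (0 <= X x)%R) ->
  \int[mu]_x ((X x)%:E * a x) = \int[mu]_x ((X x)%:E * b x).
Proof.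
move=> ma mb a0 b0 ab mX X0; apply/eqP; rewrite eq_le; apply/andP.
by split; apply: le_integralM_sub => // A GA; rewrite ab.
Qed.

End sub_sigma_algebra.

(** * Conditional expectations *)

Section integral_ge0B.
Context (d : measure_display) (T : measurableType d) (R : realType).
Variable mu : {measure set T -> \bar R}.

(** The negative part of [b - a] is at most [|a|]. *)
Lemma integral_neg_ge0B_fin_num (D : set T) (b : T -> \bar R) (a : T -> R) :
  measurable D -> measurable_fun D b -> (forall x, D x -> 0 <= b x) ->
  mu.-integrable D (EFin \o a) ->
  \int[mu]_(x in D) (fun x => b x - (a x)%:E)^\- x \is a fin_num.
Proof.
move=> mD mb b0 ia.
have ma : measurable_fun D (EFin \o a) by exact: measurable_int ia.
have mba : measurable_fun D (fun x => b x - (a x)%:E) by exact: emeasurable_funB.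
rewrite ge0_fin_numE; last by apply: integral_ge0 => x _; exact: funeneg_ge0.
have /integrableP[_] := ia; apply: le_lt_trans.
apply: ge0_le_integral => //.
- exact: measurable_funeneg.
- exact: measurableT_comp.
- move=> x Dx; rewrite funenegE ge_max abse_ge0 andbT/=.
  have := b0 x Dx; case: (b x) => [r| |]//=.
    by rewrite !lee_fin => r0; have := ler_norm (a x); lra.
  by move=> _; rewrite leNye.
Qed.

(** The integral of [b] may be infinite. Then so is that of [b - a]: [b] is at most the positive
    part of [b - a] plus [|a|], and finiteness would make [b] integrable. *)
Lemma integral_ge0B (D : set T) (b : T -> \bar R) (a : T -> R) :
  measurable D -> measurable_fun D b -> (forall x, D x -> 0 <= b x) ->
  mu.-integrable D (EFin \o a) ->
  \int[mu]_(x in D) (b x - (a x)%:E) =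
  \int[mu]_(x in D) b x - \int[mu]_(x in D) (a x)%:E.
Proof.
move=> mD mb b0 ia.
have ma : measurable_fun D (EFin \o a) by exact: measurable_int ia.
have mba : measurable_fun D (fun x => b x - (a x)%:E) by exact: emeasurable_funB.
have fina : \int[mu]_(x in D) (a x)%:E \is a fin_num := integrable_fin_num mD ia.
have Ib0 : 0 <= \int[mu]_(x in D) b x by exact: integral_ge0.
have [Ib|] := boolP (\int[mu]_(x in D) b x < +oo).
  apply: (integralB mD (f1 := b)) => //; apply/integrableP; split => //.
  by under eq_integral => x /[!inE] Dx do rewrite gee0_abs ?b0//.
rewrite -leNgt leye_eq => /eqP Ib.
rewrite Ib addye; last by move: fina; case: (\int[mu]_(x in D) (a x)%:E).
apply/eqP; rewrite -leye_eq leNgt; apply/negP.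
set h := fun x => _ : \bar R.
rewrite integralE lteBlDr ?integral_neg_ge0B_fin_num// => hy.
suff : \int[mu]_(x in D) b x < +oo by rewrite Ib ltxx.
have /integrableP[_ iaa] := ia.
apply: (@le_lt_trans _ _ (\int[mu]_(x in D) (h^\+ x + `|(a x)%:E|))).
  apply: ge0_le_integral => //.
  - apply: emeasurable_funD; first exact: measurable_funepos.
    exact: measurableT_comp.
  - move=> x Dx; rewrite funeposE /h; have := b0 x Dx; case: (b x) => [r| |]//.
      move=> _; rewrite -EFinB -EFin_max -EFinD lee_fin.
      have : (r - a x <= Num.max (r - a x) 0)%R by rewrite le_max lexx.
      by have := ler_norm (a x); lra.
rewrite ge0_integralD//.
- rewrite lte_add_pinfty//; apply: lt_le_trans hy _.
  by rewrite leey.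
- exact: measurable_funepos.
- exact: measurableT_comp.
Qed.

Lemma integral_ge0Bl (D : set T) (b : T -> \bar R) (a : T -> R) :
  measurable D -> measurable_fun D b -> (forall x, D x -> 0 <= b x) ->
  mu.-integrable D (EFin \o a) ->
  \int[mu]_(x in D) ((a x)%:E - b x) =
  \int[mu]_(x in D) (a x)%:E - \int[mu]_(x in D) b x.
Proof.
move=> mD mb b0 ia.
have fina : \int[mu]_(x in D) (a x)%:E \is a fin_num := integrable_fin_num mD ia.
transitivity (\int[mu]_(x in D) - (b x - (a x)%:E)).
  by apply: eq_integral => x _; rewrite fin_num_oppeB// addeC.
rewrite integralN; last by rewrite fin_num_adde_defl// fin_numN integral_neg_ge0B_fin_num.
by rewrite integral_ge0B// fin_num_oppeB// addeC.
Qed.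

End integral_ge0B.

Lemma measurable_pred d (T : measurableType d) (f : T -> bool) :
  measurable_fun [set: T] f -> measurable [set x | f x].
Proof. by move=> mf; have := mf measurableT [set true] I; rewrite setTI. Qed.

Section conditional_expectation_theory.
Context (d : measure_display) (T : measurableType d) (R : realType).
Variables (mu : probability T R) (G : set (set T)).
Hypotheses (sG : sigma_algebra [set: T] G) (subG : G `<=` measurable).

Local Notation TG := (g_sigma_algebraType G).

Lemma sub_measurableE (A : set T) : G.-sigma.-measurable A = G A.
Proof. by rewrite (measurable_g_measurableTypeE sG). Qed.

Definition sub_id : {mfun T >-> TG} := HB.pack (id : T -> TG)
  (isMeasurableFun.Build _ _ _ _ (id : T -> TG) (measurable_sub_id sG subG)).

(** Pushing [mu] forward along the identity restricts it to [G]; a Radon-Nikodym derivative taken on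
    this space is automatically [G]-measurable. *)
Definition sub_probability : probability TG R := distribution mu sub_id.

Lemma integral_sub_probability (A : set T) (f : T -> \bar R) :
  G A -> measurable_fun [set: TG] (f : TG -> \bar R) ->
  \int[sub_probability]_(x in A) f x = \int[mu]_(x in A) f x.
Proof.
move=> GA mf; rewrite integralE [RHS]integralE.
have mA : G.-sigma.-measurable A by rewrite sub_measurableE.
have mid := measurable_sub_id sG subG.
congr (_ - _).
- rewrite (ge0_integral_pushforward mid mu mA (f := f^\+))//.
  exact/measurable_funTS/measurable_funepos.
- rewrite (ge0_integral_pushforward mid mu mA (f := f^\-))//.
  exact/measurable_funTS/measurable_funeneg.
Qed.

(** The inequality fails only on the sets [B k] where [y < X] and [|y| <= k]; there [X - y] is
    positive with integral at most 0, so each is null. Testing on sets where [y] is bounded makes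
    [y] integrable there, which matters when [y] is a logarithm. *)
Lemma ae_le_of_integral (X : T -> \bar R) (y : T -> R) :
  measurable_fun [set: TG] (X : TG -> \bar R) ->
  measurable_fun [set: TG] (y : TG -> R) ->
  (forall (A : set T) (k : R), G A -> (forall x, A x -> (`|y x| <= k)%R) ->
    \int[mu]_(x in A) X x <= \int[mu]_(x in A) (y x)%:E) ->
  {ae mu, forall x, X x <= (y x)%:E}.
Proof.
move=> mX my Xy.
pose B k := [set x | (y x)%:E < X x] `&` [set x | (`|y x| <= k%:R)%R].
have GB k : G (B k).
  rewrite -sub_measurableE; apply: measurableI.
    rewrite -[X in measurable X]setTI.
    by apply: (@measurable_lte _ TG) => //; exact/measurable_EFinP.
  apply: (@measurable_pred _ TG).
  by apply: measurable_fun_ler => //; exact: measurableT_comp.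
suff B0 k : mu (B k) = 0.
  exists (\bigcup_k B k); split.
  - by apply: bigcup_measurable => k _; exact: subG.
  - apply/negligibleP; first by apply: bigcup_measurable => k _; exact: subG.
    by apply: negligible_bigcup => k; apply/negligibleP; [exact: subG|exact: B0].
  - move=> x /= /negP; rewrite -ltNge => yX.
    exists (truncn `|y x|).+1 => //; split=> //=.
    exact/ltW/truncnS_gt.
have mB := subG (GB k).
have mXT : measurable_fun (B k) X.
  exact/measurable_funTS/(sub_measurable_fun sG subG).
have myT : measurable_fun (B k) (EFin \o y).
  by apply/measurable_funTS/measurable_EFinP; exact: (sub_measurable_fun sG subG).
have iy : mu.-integrable (B k) (EFin \o y).
  apply: (le_integrable mB myT (g := cst k%:R%:E)).
    by move=> x [_ yk]; rewrite /= lee_fin (le_trans yk)// ler_norm.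
  exact: finite_measure_integrable_cst.
pose a x := X x - (y x)%:E.
have ma : measurable_fun (B k) a by exact: emeasurable_funB.
have a_gt0 x : B k x -> 0 < a x by move=> [yX _]; rewrite /a sube_gt0.
have Ia : \int[mu]_(x in B k) X x =
    \int[mu]_(x in B k) a x + \int[mu]_(x in B k) (y x)%:E.
  (* [X] is written as [a - (- y)] with [a] positive, since [X] itself is not known to be integrable
     or of one sign. *)
  transitivity (\int[mu]_(x in B k) (a x - (- y x)%:E)).
    by apply: eq_integral => x _; rewrite /a EFinN oppeK subeK.
  rewrite (integral_ge0B (a := fun x => - y x)%R)//.
  - congr (_ + _); rewrite -integralN; first by apply: eq_integral => x _; rewrite EFinN oppeK.
    by apply: (integrable_add_def mB); exact: (integrableN iy).
  - by move=> x Bx; exact/ltW/a_gt0.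
  - exact: (integrableN iy).
have := Xy (B k) k%:R (GB k) (fun x => @proj2 _ _).
have finy : \int[mu]_(x in B k) (y x)%:E \is a fin_num := integrable_fin_num mB iy.
rewrite Ia -leeBrDr// subee// => a0.
have : \int[mu]_(x in B k) `|a x| = 0.
  apply/eqP; rewrite eq_le integral_ge0// andbT; apply: le_trans a0.
  by under eq_integral => x /[!inE] Bx do rewrite gte0_abs ?a_gt0//.
move=> /(ae_eq_integral_abs mu mB ma) /= [N [mN N0 aN]].
apply/negligibleP => //; exists N; split => // x Bx; apply: aN => /= /(_ Bx) ax0.
by have := a_gt0 x Bx; rewrite ax0 ltxx.
Qed.

Lemma cond_exp_is_cond_exp (f g : T -> \bar R) :
  is_cond_exp mu G f g -> is_cond_exp mu G f (cond_exp mu G f).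
Proof. by move=> fg; apply: (xgetPex (cst 0) (P := is_cond_exp mu G f)); exists g. Qed.

(** This is an equality of functions and not only almost everywhere: both sides choose from the same
    set of admissible versions. *)
Lemma eq_cond_exp (f g : T -> \bar R) :
  measurable_fun [set: T] f -> measurable_fun [set: T] g ->
  {ae mu, forall x, f x = g x} -> cond_exp mu G f = cond_exp mu G g.
Proof.
move=> mf mg fg; rewrite /cond_exp; congr xget.
have E A : G A -> \int[mu]_(x in A) f x = \int[mu]_(x in A) g x.
  move=> GA; apply: ae_eq_integral; [exact: subG|exact: measurable_funTS..|].
  by apply: filterS fg => x /= ->.
by apply/seteqP; split => h [mh hE]; split => // A GA; rewrite hE// E.
Qed.

(** The charge with density [f], moved to [TG], is absolutely continuous with respect to
    [sub_probability], and its Radon-Nikodym derivative is the version. Its existence shows that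
    [cond_exp] has its defining property, and the two then agree a.e. *)
Lemma cond_exp_version (f : T -> R) : mu.-integrable [set: T] (EFin \o f) ->
  exists g : T -> R, [/\ measurable_fun [set: TG] (g : TG -> R),
    mu.-integrable [set: T] (EFin \o g),
    forall A, G A -> \int[mu]_(x in A) (g x)%:E = \int[mu]_(x in A) (f x)%:E &
    {ae mu, forall x, cond_exp mu G (EFin \o f) x = (g x)%:E}].
Proof.
move=> intf.
have mid := measurable_sub_id sG subG.
pose P := sub_probability.
pose nu : {charge set TG -> \bar R} :=
  measure_function_pushforward__canonical__charge_Charge (induced_charge intf) mid.
have mf := measurable_int mu intf.
have numu : nu `<< P.
  apply/null_content_dominatesP => A mA PA.
  have GA : G A by rewrite -sub_measurableE.
  by apply: null_set_integral; [exact: subG|exact: measurable_funTS|].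
pose g := fine \o Radon_Nikodym nu P.
have dE : EFin \o g = Radon_Nikodym nu P.
  by apply/funext => x; rewrite /g /= fineK// Radon_Nikodym_fin_num.
have idP := Radon_Nikodym_integrable numu.
have mEg : measurable_fun [set: TG] (EFin \o g : TG -> \bar R).
  by rewrite dE; exact: measurable_int idP.
have gE A : G A -> \int[mu]_(x in A) (g x)%:E = \int[mu]_(x in A) (f x)%:E.
  move=> GA; rewrite -(@integral_sub_probability A (EFin \o g) GA mEg).
  rewrite dE -Radon_Nikodym_integral//.
  by rewrite sub_measurableE.
have ig : mu.-integrable [set: T] (EFin \o g).
  apply/integrableP; split; first exact: (sub_measurable_fun sG subG mEg).
  rewrite -(@integral_sub_probability setT (fun x => `|(EFin \o g) x|)).
  - by rewrite dE; have /integrableP[] := idP.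
  - by rewrite -sub_measurableE; exact: measurableT.
  - exact: measurableT_comp.
have mg : measurable_fun [set: TG] (g : TG -> R) by exact/measurable_EFinP.
exists g; split => //.
have [mX XE] : is_cond_exp mu G (EFin \o f) (cond_exp mu G (EFin \o f)).
  apply: (@cond_exp_is_cond_exp _ (EFin \o g)); split.
    exact/(sub_measurable_funP sG).
  by move=> A GA; rewrite -gE.
have mX' := (sub_measurable_funP sG _).2 mX.
have iP : P.-integrable [set: TG] (EFin \o g) by rewrite dE.
have [|N [mN N0 NX]] := integral_ae_eq (@measurableT _ TG) iP mX'.
  move=> E _; rewrite sub_measurableE => GE.
  by rewrite !integral_sub_probability// gE// XE.
exists N; split => //; first by apply: subG; rewrite -sub_measurableE.
by move=> x /= h; apply: NX => /= /(_ I) h'; apply: h.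
Qed.

Lemma ge0_cond_exp_version (f : T -> R) :
  mu.-integrable [set: T] (EFin \o f) -> (forall x, (0 <= f x)%R) ->
  exists g : T -> R, [/\ measurable_fun [set: TG] (g : TG -> R),
    forall x, (0 <= g x)%R,
    forall A, G A -> \int[mu]_(x in A) (g x)%:E = \int[mu]_(x in A) (f x)%:E &
    {ae mu, forall x, cond_exp mu G (EFin \o f) x = (g x)%:E}].
Proof.
move=> intf f0; have [g [mg ig gE fg]] := cond_exp_version intf.
have g0 : {ae mu, forall x, 0 <= (g x)%:E}.
  apply: (@ae_le_of_integral (cst 0)) => //.
  by move=> A k GA _; rewrite integral0 gE//; apply: integral_ge0 => x _; rewrite lee_fin.
have gng : {ae mu, forall x, (g x)%:E = `|g x|%:E}.
  by apply: filterS g0 => x; rewrite lee_fin => g0; rewrite ger0_norm.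
exists (fun x => `|g x|%R); split.
- exact: measurableT_comp.
- by move=> x; exact: normr_ge0.
- move=> A GA; rewrite -gE//; have mA := subG GA.
  have mg' := sub_measurable_fun sG subG mg.
  apply: ae_eq_integral => //.
  + by apply/measurable_funTS/measurable_EFinP; exact: measurableT_comp.
  + exact/measurable_funTS/measurable_EFinP.
  + by apply: filterS gng => x /= ->.
- by move: fg gng; apply: filterS2 => x -> ->.
Qed.

(** On the zero set [Z] of a nonnegative version the integral of [f] vanishes while [f] is positive
    a.e., so [Z] is null and the value 1 may be put there. Dividing by the version is then
    legitimate at every point. *)
Lemma gt0_cond_exp_version (f : T -> R) :
  mu.-integrable [set: T] (EFin \o f) -> (forall x, (0 <= f x)%R) ->
  {ae mu, forall x, (0 < f x)%R} ->
  exists g : T -> R, [/\ measurable_fun [set: TG] (g : TG -> R),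
    forall x, (0 < g x)%R,
    forall A, G A -> \int[mu]_(x in A) (g x)%:E = \int[mu]_(x in A) (f x)%:E &
    {ae mu, forall x, cond_exp mu G (EFin \o f) x = (g x)%:E}].
Proof.
move=> intf f0 f_gt0; have [g [mg g0 gE fg]] := ge0_cond_exp_version intf f0.
have mz : measurable_fun [set: TG] (fun x : TG => g x == 0%R).
  exact: measurable_fun_eqr.
pose Z := [set x | g x == 0%R].
have GZ : G Z.
  by rewrite -sub_measurableE; exact: (@measurable_pred _ TG).
have mZ := subG GZ.
have Z0 : {ae mu, forall x, g x != 0%R}.
  have : \int[mu]_(x in Z) `|(f x)%:E| = 0.
    under eq_integral do rewrite gee0_abs ?lee_fin//.
    rewrite -gE//; apply: integral0_eq => x /eqP ->//.
  have mfZ : measurable_fun Z (EFin \o f).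
    exact/measurable_funTS/(measurable_int mu).
  move=> /(ae_eq_integral_abs mu mZ mfZ); move: f_gt0; apply: filterS2 => x fx Zx.
  by apply/negP => /Zx/= [] fx0; rewrite fx0 ltxx in fx.
exists (fun x => if g x == 0%R then 1%R else g x); split.
- exact: measurable_fun_ifT.
- by move=> x; case: ifPn => // gx; rewrite lt_neqAle eq_sym gx g0.
- move=> A GA; rewrite -gE//; have mA := subG GA.
  have mg' := sub_measurable_fun sG subG mg.
  apply: ae_eq_integral => //.
  + apply/measurable_funTS/measurable_EFinP; apply: (sub_measurable_fun sG subG).
    exact: measurable_fun_ifT.
  + exact/measurable_funTS/measurable_EFinP.
  + by apply: filterS Z0 => x /= /negbTE ->.
- by move: fg Z0; apply: filterS2 => x -> /negbTE ->.
Qed.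

(** Infinite and non-integrable [f] are included, as the tail maximal function requires. [f] is the
    sum of the bounded increments [c k] of its truncations at integer heights, and versions of these
    are summed. *)
Lemma ge0_cond_exp_exists (f : T -> \bar R) :
  measurable_fun [set: T] f -> (forall x, 0 <= f x) ->
  exists g, (forall x, 0 <= g x) /\ is_cond_exp mu G f g.
Proof.
move=> mf f0.
pose t k x := fine (mine (f x) k%:R%:E).
have tE k x : (t k x)%:E = mine (f x) k%:R%:E.
  rewrite /t fineK// ge0_fin_numE; last by rewrite le_min f0 lee_fin ler0n.
  by rewrite gt_min ltry orbT.
have mt k : measurable_fun [set: T] (t k).
  apply/measurable_EFinP; rewrite (_ : EFin \o t k = fun x => mine (f x) k%:R%:E).
    exact: measurable_mine.
  by apply/funext => x /=; rewrite tE.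
have ndt x : nondecreasing_seq (t^~ x).
  move=> m n mn; rewrite -lee_fin !tE le_min ge_min lexx /=.
  by rewrite ge_min lee_fin ler_nat mn orbT.
pose c k x := (t k.+1 x - t k x)%R.
have c0 k x : (0 <= c k x)%R by rewrite subr_ge0; exact: ndt.
have ic k : mu.-integrable [set: T] (EFin \o c k).
  apply: (le_integrable measurableT (g := cst k.+1%:R%:E)).
  - by apply/measurable_EFinP; exact: measurable_funB.
  - move=> x _; rewrite /= lee_fin ger0_norm// ger0_norm//.
    have : (t k.+1 x <= k.+1%:R)%R by rewrite -lee_fin tE ge_min lexx orbT.
    have : (0 <= t k x)%R by rewrite -lee_fin tE le_min f0 lee_fin ler0n.
    by rewrite /c; lra.
  - exact: finite_measure_integrable_cst.
have /choice[g gP] k := ge0_cond_exp_version (ic k) (c0 k).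
have fE x : f x = \sum_(k <oo) (c k x)%:E.
  apply/esym/cvg_lim => //.
  rewrite (_ : (fun _ => _) = (fun n => (t n x)%:E)); last first.
    apply/funext => n; rewrite sumEFin telescope_sumr//; congr _%:E.
    suff -> : t 0%N x = 0%R by rewrite subr0.
    by apply/eqP; rewrite -eqe tE; apply/eqP/min_idPr; exact: f0.
  rewrite (_ : (fun _ => _) = (fun n => mine (f x) n%:R%:E)); last first.
    by apply/funext => n; rewrite tE.
  have := f0 x; case: (f x) => [r| |]// r0.
    apply: cvg_near_cst; near=> n; apply/min_idPl; rewrite lee_fin.
    by near: n; exact: nbhs_infty_ger.
  rewrite (_ : (fun _ => _) = (fun n => n%:R%:E)); last first.
    by apply/funext => n; rewrite minye.
  by apply/cvgeryP; exact: cvgr_idn.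
exists (fun x => \sum_(k <oo) (g k x)%:E); split.
  by move=> x; apply: nneseries_ge0 => k _ _; rewrite lee_fin; have [] := gP k.
split.
  apply/(sub_measurable_funP sG); apply: ge0_emeasurable_sum.
    by move=> k x _ _; rewrite lee_fin; have [] := gP k.
  by move=> k _; apply/measurable_EFinP; have [] := gP k.
move=> A GA; have mA := subG GA.
have mgk k : measurable_fun A (fun x => (g k x)%:E).
  by apply/measurable_funTS/measurable_EFinP/(sub_measurable_fun sG subG); have [] := gP k.
rewrite integral_nneseries//; last first.
  by move=> k x _; rewrite lee_fin; have [] := gP k.
under [RHS]eq_integral do rewrite fE.
rewrite integral_nneseries//; last 2 first.
- by move=> k; apply/measurable_funTS; exact: measurable_int (ic k).
- by move=> k x _; rewrite lee_fin.
by apply: eq_eseriesr => k _; have [_ _ + _] := gP k; apply.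
Unshelve. all: by end_near. Qed.

Lemma ge0_cond_expP (f : T -> \bar R) :
  measurable_fun [set: T] f -> (forall x, 0 <= f x) ->
  is_cond_exp mu G f (cond_exp mu G f).
Proof. by move=> mf f0; have [g [_]] := ge0_cond_exp_exists mf f0; exact: cond_exp_is_cond_exp. Qed.

(** Meant for [ln sigma], which is bounded above by [sigma] but may have integral [-oo]. The version
    is one of [a] minus one of the nonnegative [a - f], the latter possibly infinite. *)
Lemma cond_exp_leP (f a : T -> R) :
  measurable_fun [set: T] f -> mu.-integrable [set: T] (EFin \o a) ->
  (forall x, (f x <= a x)%R) ->
  is_cond_exp mu G (EFin \o f) (cond_exp mu G (EFin \o f)).
Proof.
move=> mf ia fa; have [s [ms s_int sE _]] := cond_exp_version ia.
have ma : measurable_fun [set: T] a by apply/measurable_EFinP; exact: measurable_int ia.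
pose b x := (a x - f x)%:E.
have mb : measurable_fun [set: T] b by apply/measurable_EFinP; exact: measurable_funB.
have b0 x : 0 <= b x by rewrite lee_fin subr_ge0.
have [N [N_ge0 [mN NE]]] := ge0_cond_exp_exists mb b0.
have mN' := (sub_measurable_funP sG _).2 mN.
apply: (@cond_exp_is_cond_exp _ (fun x => (s x)%:E - N x)); split.
  apply/(sub_measurable_funP sG); apply: emeasurable_funB => //.
  exact/measurable_EFinP.
move=> A GA; have mA := subG GA.
rewrite integral_ge0Bl//; last 2 first.
- exact/measurable_funTS/(sub_measurable_fun sG subG).
- exact: integrableS s_int.
rewrite sE// NE// -integral_ge0Bl//; last 2 first.
- exact: measurable_funTS.
- exact: integrableS ia.
apply: eq_integral => x _; rewrite /b -EFinB /=; congr _%:E; lra.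
Qed.

End conditional_expectation_theory.

(** * Power inequalities behind Doob's inequality *)

Section real_inequalities.
Context {R : realType}.
Implicit Types a b m w phi p : R.

(** Young's inequality [b a^(p-1) <= b^p / p + (1 - 1/p) a^p], rearranged and divided by
    [1 - 1/p]. *)
Lemma subr_powR_le p a b : (1 < p)%R -> (0 <= a)%R -> (0 <= b)%R ->
  (b `^ p - a `^ p <= p / (p - 1) * (b `^ (p - 1) - a `^ (p - 1)) * b)%R.
Proof.
move=> p1 a0 b0.
have p0 : (0 < p)%R by lra.
have q0 : (0 < p / (p - 1))%R by rewrite divr_gt0//; lra.
have pq : (p^-1 + (p / (p - 1))^-1 = 1)%R by field; rewrite subr_eq0 !gt_eqF.
have := conjugate_powR b0 (powR_ge0 a (p - 1)) p0 q0 pq.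
rewrite -powRrM (_ : (p - 1) * (p / (p - 1)) = p)%R; last first.
  by field; rewrite subr_eq0 gt_eqF.
have bp := mulr_powRB1 b0 p0.
move: (b `^ p)%R (a `^ p)%R (b `^ (p - 1))%R (a `^ (p - 1))%R bp => B A B' A' <-.
have q1 : ((p / (p - 1))^-1 = 1 - p^-1)%R by lra.
rewrite q1 => h.
have e : (p / (p - 1) = (1 - p^-1)^-1)%R.
  by rewrite -q1 invrK.
have q2 : (0 < 1 - p^-1)%R by rewrite -q1 invr_gt0.
rewrite e -(ler_pM2l q2) !mulrA mulfV ?gt_eqF// mul1r.
nra.
Qed.

(** Let [q = p / (p - 1)] and let [s] be the dual weight [w^(-1/(p-1))]. Either [q phi <= m s / 2]
    and the first term suffices, or [m < 2 q phi / s] and the second does. The factor 1/2 lets the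
    first term be absorbed later. *)
Lemma powR_young p w m phi : (1 < p)%R -> (0 < w)%R -> (0 <= m)%R -> (0 <= phi)%R ->
  (p / (p - 1) * m `^ (p - 1) * phi <=
   2^-1 * (m `^ p * w `^ (- (p - 1)^-1)) +
   p / (p - 1) * (2 * (p / (p - 1))) `^ (p - 1) * (phi `^ p * w))%R.
Proof.
move=> p1 w0 m0 phi0.
have p0 : (0 < p)%R by lra.
have p10 : (0 < p - 1)%R by lra.
set q := (p / (p - 1))%R; have q0 : (0 < q)%R by rewrite divr_gt0.
clearbody q; set s := (w `^ _)%R; have s0 : (0 < s)%R by exact: powR_gt0.
have ws : ((s^-1) `^ (p - 1) = w)%R.
  rewrite /s powRN invrK -powRrM mulVf ?gt_eqF// powRr1// ltW//.
clearbody s.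
have [h|h] := leP (q * phi)%R (m * s / 2)%R.
  apply: (@le_trans _ _ (m `^ (p - 1) * (m * s / 2))%R).
    by rewrite [leLHS](_ : _ = m `^ (p - 1) * (q * phi))%R ?ler_wpM2l ?powR_ge0//; ring.
  rewrite -(mulr_powRB1 m0 p0) -[leLHS]addr0 lerD//.
    by rewrite le_eqVlt; apply/orP; left; apply/eqP; field.
  by apply: mulr_ge0; apply: mulr_ge0; rewrite ?powR_ge0// ltW.
have mq : (m <= 2 * q * phi / s)%R.
  by rewrite ler_pdivlMr//; lra.
rewrite -[leLHS]add0r lerD//.
  by apply: mulr_ge0 => //; apply: mulr_ge0; rewrite ?powR_ge0// ltW.
rewrite -!mulrA ler_pM2l// -(mulr_powRB1 phi0 p0).
apply: (@le_trans _ _ ((2 * q * phi / s) `^ (p - 1) * phi)%R).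
  apply: ler_wpM2r => //; apply: ge0_ler_powR; rewrite ?nnegrE ?(ltW p10)//.
  exact: le_trans m0 mq.
have q20 : (0 <= 2 * q)%R by lra.
have s10 : (0 <= s^-1)%R by rewrite invr_ge0 ltW.
rewrite (powRM _ (mulr_ge0 q20 phi0) s10) (powRM _ q20 phi0) ws.
by rewrite le_eqVlt; apply/orP; left; apply/eqP; ring.
Qed.

End real_inequalities.

(** * Suprema, running maxima and their increments *)

Definition supe (R : realType) (T : Type) (z : nat -> T -> R) (x : T) : \bar R :=
  ereal_sup (range (fun n => (z n x)%:E)).

Section supe_theory.
Context (T : Type) (R : realType).
Implicit Types z : nat -> T -> R.

Lemma le_supe z n x : (z n x)%:E <= supe z x.
Proof. by apply: ereal_sup_ubound; exists n. Qed.

Lemma supe_le z x (B : \bar R) : (forall n, (z n x)%:E <= B) -> supe z x <= B.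
Proof. by move=> zB; apply: ge_ereal_sup => _ [n _ <-]. Qed.

Lemma supe_ge0 z x : (0 <= z 0%N x)%R -> 0 <= supe z x.
Proof. by move=> z0; rewrite (le_trans _ (le_supe z 0%N x))// lee_fin. Qed.

Lemma supeM_le z x (c : R) (B : \bar R) : (0 <= c)%R -> 0 <= B ->
  (forall n, (z n x)%:E * c%:E <= B) -> supe z x * c%:E <= B.
Proof.
rewrite le_eqVlt => /predU1P[<-|c0] B0 zB; first by rewrite mule0.
by rewrite -lee_pdivlMr//; apply: supe_le => n; rewrite lee_pdivlMr.
Qed.

End supe_theory.

Lemma measurable_supe (d : measure_display) (T : measurableType d) (R : realType)
    (z : nat -> T -> R) : (forall n, measurable_fun [set: T] (z n)) ->
  measurable_fun [set: T] (supe z).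
Proof.
move=> mz; rewrite (_ : supe z = fun x => esups (fun n => (z n x)%:E) 0%N).
  by apply: measurable_fun_esups => n; exact/measurable_EFinP.
by apply/funext => x; congr ereal_sup; apply/seteqP; split => _ [n _ <-]; exists n.
Qed.

Fixpoint running_max (R : realType) (T : Type) (z : nat -> T -> R) n (x : T) : R :=
  if n is m.+1 then Num.max (running_max z m x) (z n x) else z 0%N x.

(** The value [h 0] counts as the increment at time 0, so that increments telescope to [h N] without
    a boundary term. *)
Definition increment (R : realType) (T : Type) (h : nat -> T -> R) n (x : T) : R :=
  (if n is m.+1 then h n x - h m x else h 0%N x)%R.

Section running_max_theory.
Context (T : Type) (R : realType).
Implicit Types z h : nat -> T -> R.

Lemma le_running_max z m n x : (m <= n)%N -> (z m x <= running_max z n x)%R.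
Proof.
elim: n => [|n IHn]; first by rewrite leqn0 => /eqP ->.
by rewrite leq_eqVlt => /predU1P[->|/IHn h] /=; rewrite le_max ?lexx ?orbT// h.
Qed.

Lemma running_max_ge0 z n x : (forall n, 0 <= z n x)%R -> (0 <= running_max z n x)%R.
Proof. by move=> z0; rewrite (le_trans (z0 n))// le_running_max. Qed.

Lemma running_max_nd z x : nondecreasing_seq ((running_max z)^~ x).
Proof. by apply/nondecreasing_seqP => n /=; rewrite le_max lexx. Qed.

Lemma running_max_le_supe z n x : (running_max z n x)%:E <= supe z x.
Proof.
elim: n => [|n IHn] /=; first exact: le_supe.
by rewrite EFin_max ge_max IHn le_supe.
Qed.

Lemma running_max_mono (z z' : nat -> T -> R) n x :
  (forall n, z n x <= z' n x)%R -> (running_max z n x <= running_max z' n x)%R.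
Proof.
move=> zz; elim: n => //= n IHn.
by rewrite ge_max !le_max IHn zz orbT.
Qed.

Lemma sum_increment h N x : (\sum_(k < N.+1) increment h k x)%R = h N x.
Proof.
elim: N => [|N IHN]; first by rewrite big_ord_recl big_ord0 addr0.
by rewrite big_ord_recr IHN /= addrC subrK.
Qed.

Lemma increment_ge0 h k x : (0 <= h 0%N x)%R -> nondecreasing_seq (h^~ x) ->
  (0 <= increment h k x)%R.
Proof. by case: k => // k _ ndh; rewrite /= subr_ge0; exact: ndh. Qed.

Lemma increment_running_max z k x : increment (running_max z) k x != 0%R ->
  running_max z k x = z k x.
Proof.
case: k => // k /=; case: (leP (running_max z k x) (z k.+1 x)) => //.
by rewrite subrr eqxx.
Qed.

(** A record after time 0 must exceed a nonnegative running maximum, so it cannot be set where [z]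
    vanishes. This confines the increments to the support of [z]. *)
Lemma increment_running_max_neq0 z k x : (forall n, 0 <= z n x)%R ->
  increment (running_max z) k x != 0%R -> z k x != 0%R.
Proof.
move=> z0 i0; have := increment_running_max i0; apply: contra_eq_neq => zk.
move: i0; case: k zk => [|k] //= zk; first by rewrite zk eqxx.
have := running_max_ge0 k z0.
case: (leP (running_max z k x) (z k.+1 x)) => [|_ _]; last by rewrite subrr eqxx.
rewrite zk => h1 h2; have -> : running_max z k x = 0%R by apply/eqP; rewrite eq_le h1 h2.
by rewrite subrr eqxx.
Qed.

End running_max_theory.

(** * Filtrations and Carleson embedding *)

Section filtration.
Context (d : measure_display) (T : measurableType d) (R : realType).
Variables (mu : probability T R) (F : nat -> set (set T)).
Hypotheses (sF : forall n, sigma_algebra [set: T] (F n))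
  (subF : forall n, F n `<=` measurable)
  (incF : forall m n, (m <= n)%N -> F m `<=` F n).

Local Notation TF n := (g_sigma_algebraType (F n)).
Local Notation Fmeas n f :=
  (measurable_fun [set: TF n] (f : TF n -> _)) (only parsing).

Definition adapted (z : nat -> T -> R) : Prop := forall n, Fmeas n (z n).

(* [f_] consists of everywhere nonnegative versions of the conditional
   expectations of [f]. *)
Definition is_version (f : T -> R) (f_ : nat -> T -> R) : Prop :=
  [/\ adapted f_, forall n x, (0 <= f_ n x)%R &
   forall n A, F n A ->
     \int[mu]_(x in A) (f_ n x)%:E = \int[mu]_(x in A) (f x)%:E].

Lemma Fmeas_le d' (U : measurableType d') (f : T -> U) m n : (m <= n)%N ->
  Fmeas m f -> Fmeas n f.
Proof.
move=> mn /(sub_measurable_funP (sF m)) mf.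
by apply/(sub_measurable_funP (sF n)) => B mB; apply: incF mn _ _; exact: mf.
Qed.

Lemma Fmeas_measurable d' (U : measurableType d') (f : T -> U) n :
  Fmeas n f -> measurable_fun [set: T] f.
Proof. exact: (sub_measurable_fun (sF n) (@subF n)). Qed.

Lemma Fmeas_set n (f : T -> bool) : Fmeas n f -> F n [set x | f x].
Proof.
by move=> mf; rewrite -(sub_measurableE (sF n)); exact: (@measurable_pred _ (TF n)).
Qed.

Lemma Fmeas_pred n (A : set T) : F n A -> Fmeas n (fun x => x \in A).
Proof.
move=> FA; apply: (@measurable_fun_bool _ (TF n) _ _ true); rewrite setTI.
rewrite (_ : _ @^-1` _ = A); last first.
  by apply/seteqP; split => x; [exact: set_mem|exact: mem_set].
by rewrite (sub_measurableE (sF n)).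
Qed.

Lemma adapted_running_max z : adapted z -> adapted (running_max z).
Proof.
move=> az; elim => [|n IHn] /=; first exact: az.
apply: measurable_maxr; last exact: az.
exact: Fmeas_le IHn.
Qed.

Lemma adapted_increment h : adapted h -> adapted (increment h).
Proof.
move=> ah [|n] /=; first exact: ah.
apply: measurable_funB; first exact: ah.
exact: Fmeas_le (ah n).
Qed.

Lemma version_integralM (f : T -> R) f_ n (X : T -> R) :
  is_version f f_ -> measurable_fun [set: T] f -> (forall x, (0 <= f x)%R) ->
  Fmeas n X -> (forall x, (0 <= X x)%R) ->
  \int[mu]_x ((X x)%:E * (f x)%:E) = \int[mu]_x ((X x)%:E * (f_ n x)%:E).
Proof.
move=> [af_ f_0 f_E] mf f0 mX X0.
apply: (eq_integralM_sub (sF n) (@subF n)) => //.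
- exact/measurable_EFinP.
- by apply/measurable_EFinP; exact: Fmeas_measurable (af_ n).
- by move=> x; rewrite lee_fin.
- by move=> A FA; rewrite f_E.
Qed.

(** Splits an integral by time, so that each increment, known at its own time, can be used to
    condition [a] there. *)
Lemma integral_sum_increment (h : nat -> T -> R) (a : T -> \bar R) N :
  (forall n, measurable_fun [set: T] (h n)) -> (forall x, (0 <= h 0%N x)%R) ->
  (forall x, nondecreasing_seq (h^~ x)) ->
  measurable_fun [set: T] a -> (forall x, 0 <= a x) ->
  \int[mu]_x ((h N x)%:E * a x) =
  \sum_(k < N.+1) \int[mu]_x ((increment h k x)%:E * a x).
Proof.
move=> mh h0 ndh ma a0.
have i0 k x : (0 <= increment h k x)%R by exact: increment_ge0.
rewrite -ge0_integral_sum//.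
- apply: eq_integral => x _; rewrite -ge0_sume_distrl.
    by rewrite sumEFin sum_increment.
  by move=> k _; rewrite lee_fin.
- move=> k; apply: emeasurable_funM => //; apply/measurable_EFinP.
  by case: k => -[|k] ? /=; [exact: mh|exact: measurable_funB].
- by move=> k x _; rewrite mule_ge0// lee_fin.
Qed.

Section carleson.
Variables (z : nat -> T -> R) (Q : nat -> set T) (V : nat -> T -> \bar R).
Variables (s : T -> R) (A : R).
Hypotheses (az : adapted z) (z0 : forall n x, (0 <= z n x)%R).
Hypotheses (FQ : forall n, F n (Q n)).
Hypothesis zQ : forall n x, ~ Q n x -> z n x = 0%R.
Hypotheses (mV : forall n, measurable_fun [set: T] (V n)).
Hypothesis V0 : forall n x, 0 <= V n x.
Hypotheses (ms : measurable_fun [set: T] s) (s0 : forall x, (0 <= s x)%R).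
Hypothesis A0 : (0 <= A)%R.
(** The packing condition. It is used with [V] a tail maximal function and [s] the dual weight, and
    with [V] a count of recording times and [s = 1]. *)
Hypothesis VA : forall n B, F n B -> B `<=` Q n ->
  \int[mu]_(x in B) V n x <= A%:E * \int[mu]_(x in B) (s x)%:E.

Let i0 k x : (0 <= increment (running_max z) k x)%R.
Proof. by apply: increment_ge0 => //; [exact: z0|exact: running_max_nd]. Qed.

Let Fi k : Fmeas k (increment (running_max z) k).
Proof. exact: (adapted_increment (adapted_running_max az)). Qed.

Let mi k : measurable_fun [set: T] (EFin \o increment (running_max z) k).
Proof. by apply/measurable_EFinP; exact: (Fmeas_measurable (@Fi k)). Qed.

Let iQ k x : increment (running_max z) k x != 0%R -> Q k x.
Proof.
move=> /(increment_running_max_neq0 (z0^~ x)); apply: contra_neqP => h.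
exact: zQ.
Qed.

(** Each increment is nonnegative, known at time [k] and zero off [Q k], so [VA] may be integrated
    against it; the increments then add up to the running maximum. *)
Lemma le_sum_increment N :
  \sum_(k < N.+1) \int[mu]_x ((increment (running_max z) k x)%:E * V k x) <=
  A%:E * \int[mu]_x ((running_max z N x)%:E * (s x)%:E).
Proof.
have ms' : measurable_fun [set: T] (EFin \o s) by exact/measurable_EFinP.
have s0' x : 0 <= (EFin \o s) x by rewrite lee_fin.
rewrite (integral_sum_increment (a := EFin \o s))//; last 3 first.
- by move=> n; exact: Fmeas_measurable (@adapted_running_max _ az n).
- by move=> x; exact: z0.
- by move=> x; exact: running_max_nd.
rewrite ge0_sume_distrr; last first.
  by move=> k _; apply: integral_ge0 => x _; rewrite mule_ge0// lee_fin.
apply: lee_sum => -[k kN] _ /=.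
have mQ : measurable (Q k) by exact: subF (FQ k).
(* [VA] speaks only of subsets of [Q k], so [V k] is cut off there; the increment vanishes
   elsewhere. *)
rewrite [leLHS](_ : _ = \int[mu]_x
    ((increment (running_max z) k x)%:E * (V k \_ (Q k)) x)); last first.
  apply: eq_integral => x _; rewrite patchE; case: ifPn => // xQ.
  have [->|/iQ] := eqVneq (increment (running_max z) k x) 0%R; first by rewrite !mul0e.
  by move=> /mem_set; rewrite (negbTE xQ).
pose b := (fun x => A%:E * (s x)%:E).
have b0 x : 0 <= b x by rewrite mule_ge0// lee_fin.
have mb : measurable_fun [set: T] b by exact: measurable_funeM.
apply: (@le_trans _ _ (\int[mu]_x
    ((increment (running_max z) k x)%:E * (b \_ (Q k)) x))).
  apply: (le_integralM_sub (sF k) (@subF k)) => //.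
  - by apply/(measurable_restrictT _ mQ)/measurable_funTS.
  - by apply/(measurable_restrictT _ mQ)/measurable_funTS.
  - by move=> x; apply: erestrict_ge0 => ? _.
  - by move=> x; apply: erestrict_ge0 => ? _.
  - move=> B FB; rewrite -!integral_mkcondr.
    have FBQ : F k (B `&` Q k).
      by rewrite -(sub_measurableE (sF k)); apply: measurableI; rewrite sub_measurableE.
    rewrite ge0_integralZl//; first by apply: VA => // x [].
    + by apply: subF FBQ.
    + exact: measurable_funTS.
    + by move=> x _; exact: s0'.
rewrite -ge0_integralZl//; last 2 first.
- by apply: emeasurable_funM => //; exact: mi.
- by move=> x _; rewrite mule_ge0// lee_fin.
apply: ge0_le_integral => //.
- by move=> x _; rewrite mule_ge0 ?lee_fin//; apply: erestrict_ge0 => ? _.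
- by apply: emeasurable_funM; [exact: mi|]; apply/(measurable_restrictT _ mQ)/measurable_funTS.
- by apply: measurable_funeM; apply: emeasurable_funM => //; exact: mi.
- move=> x _; rewrite patchE; case: ifPn => xQ.
    by rewrite /b muleCA.
  by rewrite mule0 !mule_ge0 ?lee_fin.
Qed.

(** Pointwise [z_n s_n] is at most the sum over [k <= n] of the increments times [s_n], and [V k]
    dominates every [s_n] with [n >= k]. The unknown time at which the supremum is reached thus
    disappears from the weight. *)
Lemma integral_supeM_le (s_ : nat -> T -> R) :
  (forall n, measurable_fun [set: T] (s_ n)) -> (forall n x, (0 <= s_ n x)%R) ->
  {ae mu, forall x, forall k n, (k <= n)%N -> (s_ n x)%:E <= V k x} ->
  \int[mu]_x supe (fun n x => (z n x * s_ n x)%R) x <=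
  A%:E * \int[mu]_x (supe z x * (s x)%:E).
Proof.
move=> ms_ s_0 sV.
have mz n : measurable_fun [set: T] (z n) by exact: Fmeas_measurable (@az n).
pose g N x := \sum_(k < N.+1) (increment (running_max z) k x)%:E * V k x.
have iV0 k x : 0 <= (increment (running_max z) k x)%:E * V k x.
  by rewrite mule_ge0// lee_fin.
apply: (ge0_le_integral_sup (g := g)).
- by move=> N; apply: emeasurable_sum => k; apply: emeasurable_funM => //; exact: mi.
- by move=> N x; apply: sume_ge0.
- by move=> x; apply/nondecreasing_seqP => N; rewrite /g [leRHS]big_ord_recr; exact: (leeDl _ (iV0 N.+1 x)).
- move=> N; rewrite /g ge0_integral_sum//; last first.
    by move=> k; apply: emeasurable_funM => //; exact: mi.
  apply: le_trans (le_sum_increment N) _; apply: lee_wpmul2l; first by rewrite lee_fin.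
  apply: ge0_le_integral => //.
  + by move=> x _; rewrite mule_ge0 ?lee_fin// running_max_ge0.
  + apply: emeasurable_funM; apply/measurable_EFinP => //.
    exact: Fmeas_measurable (@adapted_running_max _ az N).
  + apply: emeasurable_funM; last exact/measurable_EFinP.
    exact: measurable_supe.
  + by move=> x _; rewrite lee_wpmul2r ?lee_fin// running_max_le_supe.
- by apply: measurable_supe => n; exact: measurable_funM.
- by move=> x; apply: supe_ge0; rewrite mulr_ge0.
- apply: filterS sV => x sV; apply: supe_le => n.
  apply: le_trans (_ : g n x <= _); last by apply: ereal_sup_ubound; exists n.
  apply: (@le_trans _ _ (\sum_(k < n.+1)
      (increment (running_max z) k x)%:E * (s_ n x)%:E)).
    rewrite -ge0_sume_distrl; last by move=> k _; rewrite lee_fin.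
    rewrite sumEFin sum_increment EFinM lee_wpmul2r ?lee_fin//.
    exact: le_running_max.
  by apply: lee_sum => -[k kn] _; rewrite lee_wpmul2l ?lee_fin//=; exact: sV.
Qed.

End carleson.

End filtration.

(** * Weighted Doob inequality *)

(** With [q = p / (p - 1)], the factor [q (2 q)^(p-1)] is the constant of [powR_young], and the
    leading 2 comes from absorbing half of the left side. *)
Definition doob_cst (R : realType) (p : R) : R :=
  (2 * (p / (p - 1) * (2 * (p / (p - 1))) `^ (p - 1)))%R.

Lemma doob_cst_ge0 (R : realType) (p : R) : (1 < p)%R -> (0 <= doob_cst p)%R.
Proof.
move=> p1; rewrite /doob_cst mulr_ge0// mulr_ge0 ?powR_ge0// divr_ge0//; lra.
Qed.

Lemma measurable_fun_div d (T : measurableType d) (R : realType) (f g : T -> R) :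
  measurable_fun [set: T] f -> measurable_fun [set: T] g ->
  (forall x, (0 <= g x)%R) -> measurable_fun [set: T] (fun x => (f x / g x)%R).
Proof.
move=> mf mg g0; apply: measurable_funM => //.
rewrite (_ : (fun _ => _) = ((@powR R)^~ (-1)%R \o g)).
  by apply: measurableT_comp => //; exact: measurable_powR.
by apply/funext => x /=; rewrite powR_inv1.
Qed.

Section doob_inequality.
Context (d : measure_display) (T : measurableType d) (R : realType).
Variables (mu : probability T R) (F : nat -> set (set T)).
Hypotheses (sF : forall n, sigma_algebra [set: T] (F n))
  (subF : forall n, F n `<=` measurable)
  (incF : forall m n, (m <= n)%N -> F m `<=` F n).
Variables (p : R) (w phi : T -> R) (s_ phi_ : nat -> T -> R).
Hypotheses (p1 : (1 < p)%R) (mw : measurable_fun [set: T] w)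
  (w0 : {ae mu, forall x, (0 < w x)%R}).
Hypothesis int_s : mu.-integrable [set: T] (EFin \o dual_weight p w).
Hypotheses (vs : is_version mu F (dual_weight p w) s_)
  (s_gt0 : forall n x, (0 < s_ n x)%R).
Hypotheses (mphi : measurable_fun [set: T] phi) (phi0 : forall x, (0 <= phi x)%R)
  (vphi : is_version mu F phi phi_).

Local Notation TF n := (g_sigma_algebraType (F n)).
Local Notation sigma := (dual_weight p w).
Local Notation q := (p / (p - 1))%R.

Let p0 : (0 < p)%R. Proof. by apply: lt_trans p1. Qed.
Let p10 : (0 < p - 1)%R. Proof. by rewrite subr_gt0. Qed.
Let q0 : (0 < q)%R. Proof. by rewrite divr_gt0. Qed.

Let ms : measurable_fun [set: T] sigma.
Proof. by apply/measurable_EFinP; exact: measurable_int int_s. Qed.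

Let s0 x : (0 <= sigma x)%R. Proof. exact: powR_ge0. Qed.

Section capped.
Variable K : R.
Hypothesis K0 : (0 <= K)%R.

(** The cap [K] makes the left side of the estimate finite, so that half of it can be subtracted. It
    preserves [y_n s_n <= phi_n], which is what links the quotient to [phi]. *)
Let y n x : R := Num.min (phi_ n x / s_ n x)%R K.
Let m := running_max y.

Let y0 n x : (0 <= y n x)%R.
Proof. by have [_ h _] := vphi; rewrite /y le_min K0 divr_ge0// ltW. Qed.

Let m0 n x : (0 <= m n x)%R. Proof. exact: running_max_ge0. Qed.

Let mK n x : (m n x <= K)%R.
Proof. by elim: n => [|n IHn] /=; rewrite ?ge_max ?IHn /= ge_min lexx orbT. Qed.

Let am : adapted F m.
Proof.
apply: adapted_running_max => // n; apply: measurable_minr => //.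
have [+ _ _] := vphi; have [+ _ _] := vs => /(_ n) h1 /(_ n) h2.
by apply: (@measurable_fun_div _ (TF n)) => // x; exact: ltW.
Qed.

Let hp n x : R := (m n x `^ p)%R.
Let hq n x : R := (q * m n x `^ (p - 1))%R.

Let ahp : adapted F hp.
Proof. by move=> n; apply: (measurableT_comp (measurable_powR p)); exact: am. Qed.

Let ahq : adapted F hq.
Proof.
move=> n; apply: measurable_funM => //.
by apply: (measurableT_comp (measurable_powR (p - 1))); exact: am.
Qed.

Let ndhp x : nondecreasing_seq (hp^~ x).
Proof.
move=> i j ij; apply: ge0_ler_powR; rewrite ?nnegrE ?(ltW p0)//.
exact: running_max_nd.
Qed.

Let ndhq x : nondecreasing_seq (hq^~ x).
Proof.
move=> i j ij; rewrite /hq ler_pM2l//; apply: ge0_ler_powR; rewrite ?nnegrE ?(ltW p10)//.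
exact: running_max_nd.
Qed.

Let hp0 x : (0 <= hp 0%N x)%R. Proof. exact: powR_ge0. Qed.

Let hq0 x : (0 <= hq 0%N x)%R. Proof. by rewrite mulr_ge0 ?powR_ge0 ?ltW. Qed.

(** If the maximum does not move, both sides vanish. Otherwise it equals [y_k], and [subr_powR_le]
    combines with [y_k s_k <= phi_k]. Time 0 is the case of previous value 0. *)
Let le_increment k x :
  (increment hp k x * s_ k x <= increment hq k x * phi_ k x)%R.
Proof.
have ys n : (y n x * s_ n x <= phi_ n x)%R by rewrite -ler_pdivlMr// ge_min lexx.
have key a b n : (0 <= a)%R -> (0 <= b)%R -> (a <= b)%R -> b = y n x ->
    ((b `^ p - a `^ p) * s_ n x <=
     (q * b `^ (p - 1) - q * a `^ (p - 1)) * phi_ n x)%R.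
  move=> a0 b0 ab by_.
  apply: (@le_trans _ _ ((q * b `^ (p - 1) - q * a `^ (p - 1)) * (b * s_ n x))%R).
    have := subr_powR_le p1 a0 b0; rewrite -(ler_pM2r (s_gt0 n x)).
    by move=> /le_trans; apply; rewrite le_eqVlt; apply/orP; left; apply/eqP; ring.
  apply: ler_wpM2l; last by rewrite by_.
  rewrite -mulrBr mulr_ge0 ?(ltW q0)// subr_ge0.
  by apply: ge0_ler_powR; rewrite ?nnegrE ?(ltW p10).
case: k => [|k].
  have := key 0%R (m 0%N x) 0%N (lexx _) (m0 0%N x) (m0 0%N x) erefl.
  by rewrite !powR0 ?gt_eqF// mulr0 !subr0.
have [e|ne] := eqVneq (m k.+1 x) (m k x).
  by rewrite /= /hp /hq e !subrr !mul0r.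
apply: key => //; first exact: (running_max_nd y x (leqnSn k)).
by apply: increment_running_max; rewrite /= subr_eq0.
Qed.

Lemma doob_capped N :
  \int[mu]_x ((hp N x)%:E * (sigma x)%:E) <=
  (doob_cst p)%:E * \int[mu]_x (phi x `^ p * `|w x|)%:E.
Proof.
have mhp n : measurable_fun [set: T] (hp n) by exact: (Fmeas_measurable sF subF (@ahp n)).
have mhq n : measurable_fun [set: T] (hq n) by exact: (Fmeas_measurable sF subF (@ahq n)).
have ihp0 k x : (0 <= increment hp k x)%R by exact: increment_ge0.
have ihq0 k x : (0 <= increment hq k x)%R by exact: increment_ge0.
have aihp := adapted_increment sF incF ahp.
have aihq := adapted_increment sF incF ahq.
have mEs : measurable_fun [set: T] (EFin \o sigma) by exact/measurable_EFinP.
have mEphi : measurable_fun [set: T] (EFin \o phi) by exact/measurable_EFinP.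
set I := \int[mu]_x ((hp N x)%:E * (sigma x)%:E).
set J := \int[mu]_x (phi x `^ p * `|w x|)%:E.
(* The increments at time [k] are known at time [k]: [sigma] is exchanged for [s_k], [le_increment]
   is applied, and [phi_k] is exchanged back for [phi]. *)
have Ihq : I <= \int[mu]_x ((hq N x)%:E * (phi x)%:E).
  rewrite /I (integral_sum_increment mu (a := EFin \o sigma) N mhp)//.
  rewrite (integral_sum_increment mu (a := EFin \o phi) N mhq)//.
  apply: lee_sum => -[k kN] _ /=.
  rewrite (version_integralM sF subF vs ms s0 (@aihp k) (ihp0 k)).
  rewrite (version_integralM sF subF vphi mphi phi0 (@aihq k) (ihq0 k)).
  have [as_ _ _] := vs; have [aphi phi_0 _] := vphi.
  apply: ge0_le_integral => //.
  - by move=> x _; rewrite mule_ge0 ?lee_fin// ltW.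
  - apply: emeasurable_funM; apply/measurable_EFinP.
      exact: (Fmeas_measurable sF subF (@aihp k)).
    exact: (Fmeas_measurable sF subF (@as_ k)).
  - apply: emeasurable_funM; apply/measurable_EFinP.
      exact: (Fmeas_measurable sF subF (@aihq k)).
    exact: (Fmeas_measurable sF subF (@aphi k)).
  - by move=> x _; rewrite -!EFinM lee_fin.
have finI : I \is a fin_num.
  rewrite ge0_fin_numE; last by apply: integral_ge0 => x _; rewrite mule_ge0 ?lee_fin ?powR_ge0.
  apply: (@le_lt_trans _ _ (\int[mu]_x ((K `^ p)%:E * (sigma x)%:E))).
    apply: ge0_le_integral => //.
    - by move=> x _; rewrite mule_ge0 ?lee_fin ?powR_ge0.
    - by apply: emeasurable_funM => //; exact/measurable_EFinP.
    - exact: measurable_funeM.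
    - move=> x _; rewrite lee_wpmul2r ?lee_fin//.
      by apply: ge0_ler_powR; rewrite ?nnegrE ?(ltW p0).
  rewrite ge0_integralZl//; [|by move=> x _; rewrite lee_fin|by rewrite lee_fin powR_ge0].
  rewrite lte_mul_pinfty ?lee_fin ?powR_ge0//.
  exact: (integrable_lty measurableT int_s).
pose C := (q * (2 * q) `^ (p - 1))%R.
have C0 : (0 <= C)%R by rewrite mulr_ge0 ?powR_ge0 ?ltW.
have mphip : measurable_fun [set: T] (fun x => (phi x `^ p * `|w x|)%R).
  apply: measurable_funM; last exact: measurableT_comp.
  exact: (measurableT_comp (measurable_powR p)).
have IJ : I <= 2^-1%:E * I + C%:E * J.
  apply: le_trans Ihq _.
  apply: (@le_trans _ _ (\int[mu]_x (2^-1%:E * ((hp N x)%:E * (sigma x)%:E) +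
      C%:E * (phi x `^ p * `|w x|)%:E))).
    apply: ae_ge0_le_integral => //.
    - by move=> x _; rewrite mule_ge0 ?lee_fin// mulr_ge0 ?powR_ge0 ?ltW.
    - by apply: emeasurable_funM; apply/measurable_EFinP.
    - move=> x _; apply: adde_ge0; apply: mule_ge0; rewrite ?lee_fin//.
        by rewrite mulr_ge0 ?powR_ge0.
      by rewrite mulr_ge0 ?powR_ge0.
    - apply: emeasurable_funD.
        by apply: measurable_funeM; apply: emeasurable_funM => //; exact/measurable_EFinP.
      by apply: measurable_funeM; exact/measurable_EFinP.
    - apply: filterS w0 => x wx _.
      rewrite -!EFinM -EFinD lee_fin (ger0_norm (ltW wx)).
      exact: powR_young.
  rewrite ge0_integralD//.
  - rewrite ge0_integralZl//; last 2 first.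
    + by apply: emeasurable_funM => //; exact/measurable_EFinP.
    + by move=> x _; rewrite mule_ge0 ?lee_fin ?powR_ge0.
    rewrite ge0_integralZl//; first exact/measurable_EFinP.
    by move=> x _; rewrite lee_fin mulr_ge0 ?powR_ge0.
  - by move=> x _; rewrite !mule_ge0 ?lee_fin ?powR_ge0.
  - by apply: measurable_funeM; apply: emeasurable_funM => //; exact/measurable_EFinP.
  - by move=> x _; rewrite mule_ge0 ?lee_fin// mulr_ge0 ?powR_ge0.
  - by apply: measurable_funeM; exact/measurable_EFinP.
have J0 : 0 <= J by apply: integral_ge0 => x _; rewrite lee_fin mulr_ge0 ?powR_ge0.
rewrite /doob_cst -/C EFinM -muleA.
have CJ0 : 0 <= C%:E * J by rewrite mule_ge0.
move: finI IJ; clearbody I; case: I {Ihq} => // i _.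
move: CJ0; case: (C%:E * J) => [j| |]//; last by rewrite gt0_muley ?leey.
by rewrite -!EFinM -EFinD !lee_fin => _ h; lra.
Qed.

End capped.

(** [|w|] stands in for [w], which is positive only almost everywhere. *)
Lemma doob_weighted :
  \int[mu]_x (supe (fun n x => ((phi_ n x / s_ n x) `^ p)%R) x * (sigma x)%:E) <=
  (doob_cst p)%:E * \int[mu]_x (phi x `^ p * `|w x|)%:E.
Proof.
have [aphi phi_0 _] := vphi; have [as_ _ _] := vs.
pose m K := running_max (fun n x => Num.min (phi_ n x / s_ n x)%R K).
have x0 n x : (0 <= phi_ n x / s_ n x)%R by rewrite divr_ge0// ltW.
have m0 K n x : (0 <= K)%R -> (0 <= m K n x)%R.
  by move=> K0; apply: running_max_ge0 => k; rewrite le_min x0.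
have mx n : measurable_fun [set: T] (fun x => (phi_ n x / s_ n x)%R).
  apply: measurable_fun_div => //.
  - exact: (Fmeas_measurable sF subF (@aphi n)).
  - exact: (Fmeas_measurable sF subF (@as_ n)).
  - by move=> x; exact: ltW.
have mm K n : measurable_fun [set: T] (m K n).
  elim: n => [|n IHn] /=; first exact: measurable_minr.
  by apply: measurable_maxr => //; exact: measurable_minr.
(* A single index serves as cap and as time horizon, which keeps the approximants one nondecreasing
   sequence. *)
apply: (ge0_le_integral_sup
  (g := fun N x => ((m N%:R N x `^ p)%R)%:E * (sigma x)%:E)).
- move=> N; apply: emeasurable_funM; apply/measurable_EFinP => //.
  exact: (measurableT_comp (measurable_powR p)).
- by move=> N x; rewrite mule_ge0 ?lee_fin ?powR_ge0.
- move=> x i j ij; rewrite lee_wpmul2r ?lee_fin//.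
  apply: ge0_ler_powR; rewrite ?nnegrE ?(ltW p0) ?m0//.
  apply: le_trans (_ : m i%:R j x <= _)%R; first exact: running_max_nd.
  apply: running_max_mono => n; rewrite le_min !ge_min lexx /=.
  by rewrite ler_nat ij orbT.
- by move=> N; exact: doob_capped.
- apply: emeasurable_funM; last exact/measurable_EFinP.
  apply: measurable_supe => n; exact: (measurableT_comp (measurable_powR p)).
- by move=> x; rewrite mule_ge0 ?lee_fin// supe_ge0// powR_ge0.
- apply: aeW => x; apply: supeM_le => //.
    apply: le_trans (_ : 0 <= (m 0%:R 0%N x `^ p)%:E * (sigma x)%:E) _.
      by rewrite mule_ge0 ?lee_fin ?powR_ge0.
    by apply: ereal_sup_ubound; exists 0%N.
  (* The horizon [N] reaches time [n], and the cap [N] exceeds the quotient at that time, so it is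
     inactive there. *)
  move=> n; pose N := maxn n (truncn (phi_ n x / s_ n x)%R).+1.
  apply: le_trans (_ : (m N%:R N x `^ p)%:E * (sigma x)%:E <= _); last first.
    by apply: ereal_sup_ubound; exists N.
  rewrite lee_wpmul2r ?lee_fin//; apply: ge0_ler_powR; rewrite ?nnegrE ?(ltW p0) ?m0//.
  apply: le_trans (@le_running_max _ _ _ n N x _); last exact: leq_maxl.
  rewrite le_min lexx /= ltW// (lt_le_trans (truncnS_gt _))// ler_nat.
  exact: leq_maxr.
Qed.

End doob_inequality.

(** * Sparse domination of the maximal function *)

(* The last value of the sequence before time [n] that more than doubled the
   previously recorded one; [stopb] marks the recording times. *)
Fixpoint stop_level (R : realType) (T : Type) (f : nat -> T -> R) n (x : T) : R :=
  if n is m.+1 then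
    if (2 * stop_level f m x < f n x)%R then f n x else stop_level f m x
  else f 0%N x.

Definition stopb (R : realType) (T : Type) (f : nat -> T -> R) n (x : T) : bool :=
  if n is m.+1 then (2 * stop_level f m x < f n x)%R else true.

Section stop_level_theory.
Context (T : Type) (R : realType).
Variable f : nat -> T -> R.
Hypothesis f0 : forall n x, (0 <= f n x)%R.

Lemma stop_level_ge0 n x : (0 <= stop_level f n x)%R.
Proof. by elim: n => [|n IHn] /=; [exact: f0|case: ifP]. Qed.

Lemma stop_level_le n x : (stop_level f n x <= stop_level f n.+1 x)%R.
Proof. by rewrite /=; case: ifP => //; have := stop_level_ge0 n x; lra. Qed.

Lemma le_stop_level n x : (f n x <= 2 * stop_level f n x)%R.
Proof.
case: n => [|n] /=; first by have := f0 0 x; lra.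
by case: ltP => //; have := f0 n.+1 x; lra.
Qed.

Lemma stopb_level n x : stopb f n x -> stop_level f n x = f n x.
Proof. by case: n => //= n ->. Qed.

(** The level at time [N] is the value at the last recording time, hence a single term of the
    sum. *)
Lemma stop_level_powR_le p N x : (stop_level f N x `^ p <=
  \sum_(n < N.+1) (stopb f n x)%:R * f n x `^ p)%R.
Proof.
elim: N => [|N IHN]; first by rewrite big_ord_recl big_ord0 addr0 mul1r.
rewrite big_ord_recr /=; case: ifP => _; last by rewrite mul0r addr0.
by rewrite mul1r lerDr sumr_ge0// => k _; rewrite mulr_ge0 ?powR_ge0.
Qed.

Lemma powR_le_sum_stop p n N x : (0 <= p)%R -> (n <= N)%N -> (f n x `^ p <=
  2 `^ p * \sum_(n < N.+1) (stopb f n x)%:R * f n x `^ p)%R.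
Proof.
move=> p0 nN; apply: (@le_trans _ _ ((2 * stop_level f n x) `^ p)%R).
  by apply: ge0_ler_powR; rewrite ?nnegrE ?mulr_ge0 ?stop_level_ge0// le_stop_level.
rewrite powRM ?stop_level_ge0//; apply: ler_wpM2l; first exact: powR_ge0.
apply: le_trans (stop_level_powR_le p N x).
apply: ge0_ler_powR; rewrite ?nnegrE ?stop_level_ge0//.
have : nondecreasing_seq ((stop_level f)^~ x).
  by apply/nondecreasing_seqP => k; exact: stop_level_le.
exact.
Qed.

(* Each recording time after [n] more than halves the inverse of the level. *)
Lemma stopb_inv_level_le n x : (0 < stop_level f n x)%R ->
  ((stopb f n.+1 x)%:R + (stop_level f n.+1 x)^-1 * f n.+1 x <=
   (stop_level f n x)^-1 * f n.+1 x)%R.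
Proof.
move=> l0; rewrite /=; case: ifP => h; last by rewrite add0r.
have fp : (0 < f n.+1 x)%R by lra.
rewrite mulVf ?gt_eqF// [leRHS]mulrC ler_pdivlMr// (_ : true%:R = 1)%R//; lra.
Qed.

End stop_level_theory.

Section sparse.
Context (d : measure_display) (T : measurableType d) (R : realType).
Variables (mu : probability T R) (F : nat -> set (set T)).
Hypotheses (sF : forall n, sigma_algebra [set: T] (F n))
  (subF : forall n, F n `<=` measurable)
  (incF : forall m n, (m <= n)%N -> F m `<=` F n).
Variables (phi : T -> R) (phi_ : nat -> T -> R).
Hypotheses (mphi : measurable_fun [set: T] phi) (phi0 : forall x, (0 <= phi x)%R)
  (vphi : is_version mu F phi phi_).

Local Notation TF n := (g_sigma_algebraType (F n)).
Local Notation Fmeas n f :=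
  (measurable_fun [set: TF n] (f : TF n -> _)) (only parsing).
Local Notation L := (stop_level phi_).

Let aphi : adapted F phi_. Proof. by case: vphi. Qed.
Let phi_0 n x : (0 <= phi_ n x)%R. Proof. by case: vphi. Qed.

Lemma adapted_stop_level : adapted F L.
Proof.
elim => [|n IHn] /=; first exact: aphi.
have IHn' : Fmeas n.+1 (L n) by exact: (Fmeas_le sF incF (leqnSn n)).
apply: measurable_fun_ifT => //.
by apply: measurable_fun_ltr; [exact: measurable_funM|exact: aphi].
Qed.

Lemma Fmeas_stopb n : Fmeas n (stopb phi_ n).
Proof.
case: n => [|n]; first exact: measurable_cst.
apply: measurable_fun_ltr; last exact: aphi.
apply: measurable_funM => //.
exact: (Fmeas_le sF incF (leqnSn n) (@adapted_stop_level n)).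
Qed.

Lemma Fmeas_natr n (b : T -> bool) : Fmeas n b -> Fmeas n (fun x => (b x)%:R : R).
Proof.
move=> mb; rewrite (_ : (fun _ => _) = fun x => if b x then 1%R else 0%R : R).
  exact: (@measurable_fun_ifT _ _ (TF n)).
by apply/funext => x; case: (b x).
Qed.

(** Takes the part of [V] in the Carleson embedding; the bound on its integrals is the sparseness of
    the recording times. *)
Let count k N x : R := (\sum_(m < N.+1 | (k <= m)%N) (stopb phi_ m x)%:R)%R.

Let count_ge0 k N x : (0 <= count k N x)%R.
Proof. by apply: sumr_ge0. Qed.

Let mcount k N : measurable_fun [set: T] (count k N).
Proof.
rewrite (_ : count k N = fun x =>
    \sum_(m < N.+1) if (k <= m)%N then (stopb phi_ m x)%:R else 0)%R; last first.
  by apply/funext => x; rewrite /count [LHS]big_mkcond.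
apply: measurable_sum => m; case: (k <= m)%N => //.
exact: (Fmeas_measurable sF subF (Fmeas_natr (@Fmeas_stopb m))).
Qed.

(** A potential argument. At [j = 0] both integrals equal [mu B], the source of the 2. At each later
    step [phi] is conditioned at the new time; a recording there adds 1 to the count, while the
    quotient loses at least 1. *)
Let integral_count_add k B j : F k B ->
  (forall x, B x -> stopb phi_ k x /\ (0 < phi_ k x)%R) ->
  \int[mu]_(x in B) (count k (k + j) x)%:E +
  \int[mu]_(x in B) ((L (k + j) x)^-1 * phi x)%:E <= 2%:E * mu B.
Proof.
move=> FB BQ; have mB := subF FB.
have Lpos n x : B x -> (0 < L (k + n) x)%R.
  move=> Bx; have [sk pk] := BQ x Bx; apply: lt_le_trans pk _.
  rewrite -(stopb_level sk).
  have : nondecreasing_seq (L^~ x).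
    by apply/nondecreasing_seqP => i; exact: stop_level_le.
  by apply; exact: leq_addr.
have aLV n : Fmeas n (fun x => (L n x)^-1)%R.
  rewrite (_ : (fun _ => _) = ((@powR R)^~ (-1)%R \o L n)); last first.
    by apply/funext => x /=; rewrite powR_inv1// stop_level_ge0.
  apply: (measurableT_comp (measurable_powR (-1))); exact: adapted_stop_level.
have LV0 n x : (0 <= (L n x)^-1)%R by rewrite invr_ge0 stop_level_ge0.
have mLV n : measurable_fun [set: T] (fun x => (L n x)^-1)%R.
  exact: (Fmeas_measurable sF subF (@aLV n)).
have aB n : (k <= n)%N -> Fmeas n (fun x => (x \in B)%:R : R).
  by move=> kn; apply: Fmeas_natr; apply: (Fmeas_pred sF); exact: (incF kn).
(* The set [B] and the levels up to time [n] are known at time [n], so [phi] and [phi_n] are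
   interchangeable against them. *)
have trade m n : (k <= n)%N -> (m <= n)%N ->
  \int[mu]_(x in B) ((L m x)^-1 * phi x)%:E =
  \int[mu]_(x in B) ((L m x)^-1 * phi_ n x)%:E.
  move=> kn mn.
  have E (g : T -> R) : \int[mu]_(x in B) ((L m x)^-1 * g x)%:E =
      \int[mu]_x (((x \in B)%:R * (L m x)^-1)%:E * (g x)%:E).
    rewrite integral_mkcond; apply: eq_integral => x _; rewrite patchE.
    by case: (x \in B); rewrite ?mul0r ?mul0e// mul1r.
  rewrite !E; apply: (version_integralM sF subF vphi) => //.
  - apply: measurable_funM; first exact: aB.
    exact: (Fmeas_le sF incF mn (@aLV m)).
  - by move=> x; rewrite mulr_ge0.
have mf (f : T -> R) : measurable_fun [set: T] f -> measurable_fun B (EFin \o f).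
  by move=> ?; exact/measurable_funTS/measurable_EFinP.
have mphin n : measurable_fun [set: T] (phi_ n).
  exact: (Fmeas_measurable sF subF (@aphi n)).
have mstop n : measurable_fun [set: T] (fun x => (stopb phi_ n x)%:R : R).
  exact: (Fmeas_measurable sF subF (Fmeas_natr (@Fmeas_stopb n))).
elim: j => [|j IHj].
  rewrite addn0 (trade k k)//.
  have -> : \int[mu]_(x in B) (count k k x)%:E = mu B.
    rewrite (_ : mu B = \int[mu]_(x in B) (cst 1) x); last first.
      by rewrite integral_cst// mul1e.
    apply: eq_integral => x /set_mem Bx; have [sk _] := BQ x Bx.
    rewrite /count big_mkcond big_ord_recr/= leqnn sk big1 ?add0r//.
    by move=> i _; rewrite leqNgt ltn_ord.
  have -> : \int[mu]_(x in B) ((L k x)^-1 * phi_ k x)%:E = mu B.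
    rewrite (_ : mu B = \int[mu]_(x in B) (cst 1) x); last first.
      by rewrite integral_cst// mul1e.
    apply: eq_integral => x /set_mem Bx; have [sk pk] := BQ x Bx.
    by rewrite (stopb_level sk) mulVf// gt_eqF.
  by rewrite (_ : 2 = 1 + 1)%R// EFinD ge0_muleDl// mul1e.
apply: le_trans IHj.
have -> : \int[mu]_(x in B) (count k (k + j.+1) x)%:E =
    \int[mu]_(x in B) (count k (k + j) x)%:E +
    \int[mu]_(x in B) ((stopb phi_ (k + j).+1 x)%:R)%:E.
  rewrite -ge0_integralD//; [|by move=> x _; rewrite lee_fin|exact: mf|exact: mf].
  apply: eq_integral => x _; rewrite -EFinD addnS; congr _%:E.
  by rewrite /count big_mkcond big_ord_recr/= -big_mkcond/= leqW ?leq_addr.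
rewrite -addeA leeD2l// addnS.
have kj : (k <= (k + j).+1)%N by rewrite leqW ?leq_addr.
rewrite (trade (k + j)%N (k + j).+1)// (trade (k + j).+1 (k + j).+1)//.
have mLp m n : measurable_fun [set: T] (fun x => (L m x)^-1 * phi_ n x)%R.
  exact: measurable_funM.
rewrite -ge0_integralD//.
- apply: ge0_le_integral => //.
  + by move=> x _; rewrite adde_ge0// lee_fin ?mulr_ge0.
  + by apply: emeasurable_funD; [exact: mf|exact: mf].
  + exact: mf.
  + by move=> x Bx; rewrite -EFinD lee_fin stopb_inv_level_le// Lpos.
- exact: mf.
- by move=> x _; rewrite lee_fin mulr_ge0.
- exact: mf.
Qed.

(** The Carleson embedding with [z] the part of [Z] at recording times, [V] the number of recordings
    still to come and weight 1. Time 0 is recorded even where [phi_0] vanishes, whereas the packing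
    bound needs a positive level; this is why [Z] must vanish with [phi]. *)
Lemma integral_sparse_le (Z : nat -> T -> R) N : adapted F Z ->
  (forall n x, (0 <= Z n x)%R) -> (forall n x, phi_ n x = 0%R -> Z n x = 0%R) ->
  \sum_(n < N.+1) \int[mu]_x ((stopb phi_ n x)%:R * Z n x)%:E <=
  2%:E * \int[mu]_x supe Z x.
Proof.
move=> aZ Z0 Zphi.
pose z n x : R := ((stopb phi_ n x)%:R * Z n x)%R.
pose Q n := [set x | stopb phi_ n x && (0 < phi_ n x)%R].
have az : adapted F z.
  by move=> n; apply: measurable_funM; [apply: Fmeas_natr; exact: Fmeas_stopb|exact: aZ].
have mz n : measurable_fun [set: T] (z n) by exact: (Fmeas_measurable sF subF (@az n)).
have mZ n : measurable_fun [set: T] (Z n) by exact: (Fmeas_measurable sF subF (@aZ n)).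
have z0 n x : (0 <= z n x)%R by rewrite mulr_ge0.
have zZ n x : (z n x <= Z n x)%R.
  by rewrite /z; case: stopb; rewrite ?mul1r// mul0r.
have FQ n : F n (Q n).
  apply: (Fmeas_set sF); apply: measurable_and; first exact: Fmeas_stopb.
  by apply: measurable_fun_ltr => //; exact: aphi.
have zQ n x : ~ Q n x -> z n x = 0%R.
  move=> /negP; rewrite /z negb_and => /orP[/negbTE ->|]; first by rewrite mul0r.
  by rewrite -leNgt => h; rewrite Zphi ?mulr0//; apply/eqP; rewrite eq_le h phi_0.
pose V n x := (count n N x)%:E.
have mV n : measurable_fun [set: T] (V n) by exact/measurable_EFinP.
have V0 n x : 0 <= V n x by rewrite lee_fin.
have VA n B : F n B -> B `<=` Q n ->
    \int[mu]_(x in B) V n x <= 2%:E * \int[mu]_(x in B) ((cst 1%R : T -> R) x)%:E.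
  move=> FB BQ; have mB := subF FB.
  have -> : \int[mu]_(x in B) ((cst 1%R : T -> R) x)%:E = mu B.
    by have := integral_cst mu mB 1%E; rewrite mul1e; exact.
  (* Recordings after the horizon [N] are not counted, so for [n > N] the left side is 0. *)
  have [nN|Nn] := leqP n N.
    rewrite -(subnKC nN) in V mV V0 *.
    apply: le_trans (_ : _ + _ <= _); last first.
      apply: (@integral_count_add n B (N - n) FB) => x /BQ.
      by rewrite /Q /= => /andP[].
    rewrite /V (subnKC nN) leeDl//; apply: integral_ge0 => x _.
    by rewrite lee_fin mulr_ge0// invr_ge0 stop_level_ge0.
  rewrite (_ : \int[mu]_(x in B) _ = 0) ?mule_ge0//.
  apply: integral0_eq => x _; rewrite /V /count big1// => i ni.
  by move: (leq_ltn_trans ni (ltn_ord i)); rewrite ltnS leqNgt Nn.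
have := le_sum_increment sF subF incF az z0 FQ zQ mV V0
  (measurable_cst (1%R : R)) (fun=> ler01) (ler0n _ 2) VA N.
have i0 k x : (0 <= increment (running_max z) k x)%R.
  by apply: increment_ge0; [exact: z0|exact: running_max_nd].
have mi k : measurable_fun [set: T] (EFin \o increment (running_max z) k).
  apply/measurable_EFinP; apply: (Fmeas_measurable (n := k) sF subF).
  exact: (adapted_increment sF incF (adapted_running_max sF incF az)).
move=> h; apply: le_trans (le_trans h _).
  rewrite -!ge0_integral_sum//.
  - apply: ge0_le_integral => //.
    + by move=> x _; apply: sume_ge0 => k _; rewrite lee_fin mulr_ge0.
    + by apply: emeasurable_sum => k; apply/measurable_EFinP; exact: mz.
    + by apply: emeasurable_sum => k; apply: emeasurable_funM; [exact: mi|exact: mV].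
    + move=> x _; rewrite sumEFin.
      under [leRHS]eq_bigr do rewrite /V -EFinM.
      rewrite sumEFin lee_fin.
      (* At a recording time [Z_n] is at most the running maximum of [z]; expanding that into
         increments and exchanging the sums turns the recordings into [count]. *)
      apply: (@le_trans _ _ (\sum_(n < N.+1) \sum_(k < N.+1 | (k <= n)%N)
          (stopb phi_ n x)%:R * increment (running_max z) k x)%R).
        apply: ler_sum => -[n nN] _ /=; rewrite -mulr_sumr.
        have -> : (\sum_(k < N.+1 | (k <= n)%N) increment (running_max z) k x)%R =
            running_max z n x.
          rewrite -(sum_increment (running_max z) n x).
          by rewrite (big_ord_widen N.+1 (fun k => increment (running_max z) k x)).
        case: (boolP (stopb phi_ n x)) => sn; last by rewrite !mul0r.
        rewrite !mul1r; apply: le_trans (@le_running_max _ _ z n n x (leqnn n)).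
        by rewrite /z sn mul1r.
      rewrite (exchange_big_dep xpredT)//=.
      apply: ler_sum => k _; rewrite /count mulr_sumr.
      by apply: ler_sum => n _; rewrite mulrC.
  - by move=> k; apply: emeasurable_funM; [exact: mi|exact: mV].
  - by move=> k x _; rewrite mule_ge0 ?lee_fin.
  - by move=> k; apply/measurable_EFinP; exact: mz.
  - by move=> k x _; rewrite lee_fin mulr_ge0.
apply: lee_wpmul2l; first by rewrite lee_fin.
apply: ge0_le_integral => //.
- by move=> x _; rewrite mule_ge0 ?lee_fin// running_max_ge0.
- apply: emeasurable_funM; last exact/measurable_EFinP.
  apply/measurable_EFinP; apply: (Fmeas_measurable (n := N) sF subF).
  exact: (adapted_running_max sF incF az).
- exact: measurable_supe.
- move=> x _; rewrite /cst mule1; apply: le_trans (running_max_le_supe Z N x).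
  by rewrite lee_fin; exact: running_max_mono.
Qed.

(** [2^p] comes from the sparse domination and 2 from sparseness. On each recorded event [u] is
    conditioned to [u_n], and the pointwise hypothesis distributes the result among the [Z j]. The
    index [j] serves the slices of the third bound; the other two take [J = 1]. *)
Lemma integral_supe_powR_le (p : R) (u : T -> R) (u_ : nat -> T -> R)
    (J : nat) (K : nat -> R) (Z : nat -> nat -> T -> R) :
  (0 < p)%R -> measurable_fun [set: T] u -> (forall x, (0 <= u x)%R) ->
  is_version mu F u u_ -> (forall j, (0 <= K j)%R) ->
  (forall j, adapted F (Z j)) -> (forall j n x, (0 <= Z j n x)%R) ->
  (forall j n x, phi_ n x = 0%R -> Z j n x = 0%R) ->
  (forall n, {ae mu, forall x,
    (phi_ n x `^ p * u_ n x <= \sum_(j < J) K j * Z j n x)%R}) ->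
  \int[mu]_x (supe (fun n x => (phi_ n x `^ p)%R) x * (u x)%:E) <=
  (2 `^ p * 2)%:E * \sum_(j < J) (K j)%:E * \int[mu]_x supe (Z j) x.
Proof.
move=> p0 mu_ u0 vu K0 aZ Z0 Zphi phiZ.
have [au u_0 _] := vu.
have mZ j n : measurable_fun [set: T] (Z j n).
  exact: (Fmeas_measurable sF subF (@aZ j n)).
have ap : adapted F (fun n x => (phi_ n x `^ p)%R).
  by move=> n; apply: (measurableT_comp (measurable_powR p)); exact: aphi.
have asp : adapted F (fun n x => ((stopb phi_ n x)%:R * phi_ n x `^ p)%R).
  by move=> n; apply: measurable_funM; [apply: Fmeas_natr; exact: Fmeas_stopb|exact: ap].
have mp n : measurable_fun [set: T] (fun x => (phi_ n x `^ p)%R).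
  exact: (Fmeas_measurable sF subF (@ap n)).
have msp n : measurable_fun [set: T] (fun x => ((stopb phi_ n x)%:R * phi_ n x `^ p)%R).
  exact: (Fmeas_measurable sF subF (@asp n)).
have sp0 n x : (0 <= (stopb phi_ n x)%:R * phi_ n x `^ p)%R.
  by rewrite mulr_ge0 ?powR_ge0.
have mstop n : measurable_fun [set: T] (fun x => (stopb phi_ n x)%:R : R).
  exact: (Fmeas_measurable sF subF (Fmeas_natr (@Fmeas_stopb n))).
have mEu : measurable_fun [set: T] (EFin \o u) by exact/measurable_EFinP.
pose g N x := (2 `^ p)%:E * \sum_(n < N.+1)
  ((stopb phi_ n x)%:R * phi_ n x `^ p)%:E * (u x)%:E.
have mt n : measurable_fun [set: T] (fun x =>
    ((stopb phi_ n x)%:R * phi_ n x `^ p)%:E * (u x)%:E).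
  by apply: emeasurable_funM => //; exact/measurable_EFinP.
have t0 n x : 0 <= ((stopb phi_ n x)%:R * phi_ n x `^ p)%:E * (u x)%:E.
  by rewrite mule_ge0// lee_fin.
have p20 : 0 <= (2 `^ p : R)%:E by rewrite lee_fin powR_ge0.
apply: (ge0_le_integral_sup (g := g)).
- by move=> N; apply: measurable_funeM; apply: emeasurable_sum => n; exact: mt.
- by move=> N x; rewrite mule_ge0// sume_ge0.
- move=> x; apply/nondecreasing_seqP => N; apply: lee_wpmul2l => //.
  rewrite [leRHS]big_ord_recr; exact: (leeDl _ (t0 N.+1 x)).
- move=> N; rewrite /g ge0_integralZl//; last 2 first.
  + by apply: emeasurable_sum => n; exact: mt.
  + by move=> x _; exact: sume_ge0.
  rewrite EFinM -muleA; apply: lee_wpmul2l => //.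
  rewrite ge0_integral_sum//.
  apply: (@le_trans _ _ (\sum_(n < N.+1) \sum_(j < J)
      (K j)%:E * \int[mu]_x ((stopb phi_ n x)%:R * Z j n x)%:E)).
    apply: lee_sum => -[n nN] _ /=.
    rewrite (version_integralM sF subF vu mu_ u0 (@asp n) (sp0 n)).
    have mKZ j : measurable_fun [set: T] (fun x =>
        (K j)%:E * ((stopb phi_ n x)%:R * Z j n x)%:E).
      by apply: measurable_funeM; apply/measurable_EFinP; exact: measurable_funM.
    have KZ0 j x : 0 <= (K j)%:E * ((stopb phi_ n x)%:R * Z j n x)%:E.
      by rewrite mule_ge0 ?lee_fin// mulr_ge0.
    apply: (@le_trans _ _ (\int[mu]_x (\sum_(j < J)
        (K j)%:E * ((stopb phi_ n x)%:R * Z j n x)%:E))).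
      apply: ae_ge0_le_integral => //.
      - by move=> x _; rewrite mule_ge0 ?lee_fin.
      - apply: emeasurable_funM; apply/measurable_EFinP => //.
        exact: (Fmeas_measurable sF subF (@au n)).
      - by move=> x _; apply: sume_ge0.
      - by apply: emeasurable_sum => j; exact: mKZ.
      - apply: filterS (phiZ n) => x h _.
        under [leRHS]eq_bigr do rewrite -EFinM.
        rewrite sumEFin -EFinM lee_fin -mulrA.
        apply: le_trans (ler_wpM2l _ h) _ => //.
        rewrite mulr_sumr; apply: ler_sum => j _.
        by rewrite mulrCA.
    rewrite ge0_integral_sum//; apply: lee_sum => j _.
    rewrite ge0_integralZl// ?lee_fin//.
    - by apply/measurable_EFinP; exact: measurable_funM.
    - by move=> x _; rewrite lee_fin mulr_ge0.
  rewrite exchange_big/= ge0_sume_distrr; last first.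
    by move=> j _; rewrite mule_ge0 ?lee_fin//; apply: integral_ge0 => x _; exact: supe_ge0.
  apply: lee_sum => j _; rewrite muleCA -ge0_sume_distrr; last first.
    by move=> n _; apply: integral_ge0 => x _; rewrite lee_fin mulr_ge0.
  apply: lee_wpmul2l; first by rewrite lee_fin.
  by apply: integral_sparse_le => // n x; exact: Zphi.
- apply: emeasurable_funM => //; exact: measurable_supe.
- by move=> x; rewrite mule_ge0 ?lee_fin// supe_ge0// powR_ge0.
- apply: aeW => x; apply: supeM_le => //.
    apply: le_trans (_ : 0 <= g 0%N x) _; first by rewrite mule_ge0// sume_ge0.
    by apply: ereal_sup_ubound; exists 0%N.
  move=> n; apply: le_trans (_ : g n x <= _); last by apply: ereal_sup_ubound; exists n.
  rewrite /g -ge0_sume_distrl; last by move=> k _; rewrite lee_fin.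
  rewrite muleA lee_wpmul2r ?lee_fin// sumEFin -EFinM lee_fin.
  by apply: powR_le_sum_stop => //; exact: ltW.
Qed.

End sparse.

(** * Pointwise inequalities for the dual weight *)

Section dual_weight_inequalities.
Context {R : realType}.
Implicit Types p w phi : R.

Lemma dual_weightK p w : (1 < p)%R -> (0 < w)%R ->
  ((w `^ (- (p - 1)^-1)) `^ (p - 1) * w = 1)%R.
Proof.
move=> p1 w0; have p10 : (p - 1 != 0)%R by rewrite subr_eq0 gt_eqF.
by rewrite -powRrM mulNr mulVf// powR_inv1 ?ltW// mulVf// gt_eqF.
Qed.

(** If [phi] exceeds the dual weight [s], then [phi^(p-1) w >= s^(p-1) w = 1]. Integrated, this is
    the inclusion of $L^p(w)$ in $L^1$. *)
Lemma le_powR_dual p w phi : (1 < p)%R -> (0 < w)%R -> (0 <= phi)%R ->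
  (phi <= phi `^ p * w + w `^ (- (p - 1)^-1))%R.
Proof.
move=> p1 w0 phi0; set s := (w `^ _)%R.
have s0 : (0 < s)%R by exact: powR_gt0.
have p0 : (0 < p)%R by lra.
have [h|h] := leP phi s.
  by rewrite -[leLHS]add0r lerD// mulr_ge0 ?powR_ge0// ltW.
rewrite -[leLHS]addr0 lerD ?(ltW s0)//.
rewrite -(mulr_powRB1 phi0 p0) -mulrA -[leLHS]mulr1 ler_wpM2l//.
rewrite -[leLHS](dual_weightK p1 w0) ler_wpM2r ?(ltW w0)//.
by apply: ge0_ler_powR; rewrite ?nnegrE ?subr_ge0 ?(ltW p1) ?(ltW s0) ?(ltW h).
Qed.

(* Young's inequality applied to
   [1 = (w / a)^(1/p) (sigma / s)^((p-1)/p) (a s^(p-1))^(1/p)]. *)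
Lemma dual_weight_young p w a s : (1 < p)%R -> (0 < w)%R -> (0 < a)%R -> (0 < s)%R ->
  ((a * s `^ (p - 1)) `^ (- p^-1) <=
   p^-1 * (w / a) + (1 - p^-1) * (w `^ (- (p - 1)^-1) / s))%R.
Proof.
move=> p1 w0 a0 s0; set sg := (w `^ _)%R.
have sg0 : (0 < sg)%R by exact: powR_gt0.
have p0 : (0 < p)%R by lra.
have p10 : (0 < p - 1)%R by lra.
have q0 : (0 < p / (p - 1))%R by rewrite divr_gt0.
have qV : ((p / (p - 1))^-1 = 1 - p^-1)%R by field; rewrite subr_eq0 !gt_eqF.
have pq : (p^-1 + (p / (p - 1))^-1 = 1)%R by rewrite qV; lra.
have e1 : (((w / a) `^ p^-1) `^ p = w / a)%R.
  by rewrite -powRrM mulVf ?gt_eqF// powRr1// divr_ge0// ltW.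
have e2 : (((sg / s) `^ (1 - p^-1)) `^ (p / (p - 1)) = sg / s)%R.
  by rewrite -powRrM -qV mulVf ?gt_eqF// powRr1// divr_ge0// ltW.
have := conjugate_powR (powR_ge0 (w / a) p^-1)
  (powR_ge0 (sg / s) (1 - p^-1)) p0 q0 pq.
rewrite e1 e2 qV.
suff -> : ((a * s `^ (p - 1)) `^ (- p^-1) = (w / a) `^ p^-1 * (sg / s) `^ (1 - p^-1))%R.
  by move=> h; apply: le_trans h _; rewrite le_eqVlt; apply/orP; left; apply/eqP; ring.
have e : (1 - p^-1 = (p - 1) * p^-1)%R by field; rewrite gt_eqF.
have wa0 : (0 <= w / a)%R by rewrite divr_ge0// ltW.
have X0 : (0 <= a * s `^ (p - 1))%R by rewrite mulr_ge0 ?powR_ge0// ltW.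
have sV : ((s^-1) `^ (p - 1) = (s `^ (p - 1))^-1)%R.
  by rewrite -[(s^-1)%R](powR_inv1 (ltW s0)) -powRrM mulN1r powRN.
have XV : (w / a * (sg / s) `^ (p - 1) = (a * s `^ (p - 1))^-1)%R.
  rewrite powRM ?(ltW sg0) ?invr_ge0 ?(ltW s0)// sV invfM.
  transitivity (sg `^ (p - 1) * w * (a^-1 * (s `^ (p - 1))^-1))%R; first ring.
  by rewrite dual_weightK// mul1r.
rewrite e powRrM -(powRM _ wa0 (powR_ge0 _ _)) XV.
by rewrite -(powR_inv1 X0) -powRrM mulN1r.
Qed.

End dual_weight_inequalities.

Lemma poweRVK (R : realType) (r : R) (x : \bar R) : (0 < r)%R -> 0 <= x -> (x `^ r^-1) `^ r = x.
Proof. by move=> r0 x0; rewrite -poweRrM mulVf ?gt_eqF// poweRe1. Qed.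

Lemma poweRKV (R : realType) (r : R) (x : \bar R) : (0 < r)%R -> 0 <= x -> (x `^ r) `^ r^-1 = x.
Proof. by move=> r0 x0; rewrite -poweRrM mulfV ?gt_eqF// poweRe1. Qed.

Lemma le_poweR (R : realType) (r : R) (x y : \bar R) : (0 <= r)%R -> 0 <= x -> x <= y ->
  x `^ r <= y `^ r.
Proof.
move=> r0 x0 xy; apply: gt0_ler_poweR => //; rewrite in_itv/= ?x0 ?leey//.
by rewrite (le_trans x0 xy).
Qed.

(** * Adapted versions of weights and of test functions *)

Section versions.
Context (d : measure_display) (T : measurableType d) (R : realType).
Variables (mu : probability T R) (F : nat -> set (set T)).
Hypotheses (sF : forall n, sigma_algebra [set: T] (F n))
  (subF : forall n, F n `<=` measurable).

Local Notation TF n := (g_sigma_algebraType (F n)).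

Lemma exists_version (f : T -> R) : mu.-integrable [set: T] (EFin \o f) ->
  (forall x, (0 <= f x)%R) ->
  exists f_, is_version mu F f f_ /\
    forall n, {ae mu, forall x, cond_exp mu (F n) (EFin \o f) x = (f_ n x)%:E}.
Proof.
move=> fi f0; have /choice[f_ f_P] n := ge0_cond_exp_version (sF n) (@subF n) fi f0.
by exists f_; split => [|n]; [split => n; have [] := f_P n|have [] := f_P n].
Qed.

Lemma exists_gt0_version (f : T -> R) : mu.-integrable [set: T] (EFin \o f) ->
  (forall x, (0 <= f x)%R) -> {ae mu, forall x, (0 < f x)%R} ->
  exists f_, [/\ is_version mu F f f_, forall n x, (0 < f_ n x)%R &
    forall n, {ae mu, forall x, cond_exp mu (F n) (EFin \o f) x = (f_ n x)%:E}].
Proof.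
move=> fi f0 fp; have /choice[f_ f_P] n := gt0_cond_exp_version (sF n) (@subF n) fi f0 fp.
exists f_; split => [|n|n]; [|by have [] := f_P n|by have [] := f_P n].
by split => [n|n x|n]; [have [] := f_P n|have [_ h _ _] := f_P n; exact/ltW|have [] := f_P n].
Qed.

(** A weight is positive only almost everywhere, so its absolute value is conditioned instead; by
    [eq_cond_exp] the conditional expectation is the same function. *)
Lemma weight_version (u : T -> R) : weight mu u ->
  exists u_, [/\ is_version mu F (fun x => `|u x|%R) u_,
    forall n x, (0 < u_ n x)%R &
    forall n, {ae mu, forall x, cond_exp mu (F n) (EFin \o u) x = (u_ n x)%:E}].
Proof.
move=> [iu u0].
have iau : mu.-integrable [set: T] (EFin \o (fun x => `|u x|%R)).
  exact: (integrable_norm iu).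
have up : {ae mu, forall x, (0 < `|u x|)%R}.
  by apply: filterS u0 => x ux; rewrite normr_gt0 gt_eqF.
have [u_ [vu u_0 uE]] := exists_gt0_version iau (fun x => normr_ge0 _) up.
exists u_; split => // n.
rewrite (@eq_cond_exp _ _ _ _ _ (@subF n) (EFin \o u) (EFin \o (fun x => `|u x|%R))) //.
- exact: measurable_int iu.
- exact: measurable_int iau.
- by apply: filterS u0 => x ux /=; rewrite gtr0_norm.
Qed.

(** The factor $1_A/f_n$ is known at time [n], so [f] may be exchanged for [f_n] against it. *)
Lemma integral_version_div (f : T -> R) f_ n (A : set T) : is_version mu F f f_ ->
  measurable_fun [set: T] f -> (forall x, (0 <= f x)%R) ->
  (forall n x, (0 < f_ n x)%R) -> F n A ->
  \int[mu]_(x in A) (f x / f_ n x)%:E = mu A.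
Proof.
move=> vf mf f0 f_0 FA; have [af _ _] := vf.
have mA := subF FA.
have aX : measurable_fun [set: TF n] (fun x : TF n => ((x \in A)%:R / f_ n x : R)%R).
  apply: (@measurable_fun_div _ (TF n)).
  - by apply: Fmeas_natr; exact: (Fmeas_pred sF).
  - exact: af.
  - by move=> x; exact: ltW.
transitivity (\int[mu]_x (((x \in A)%:R / f_ n x)%:E * (f x)%:E)).
  rewrite integral_mkcond; apply: eq_integral => x _; rewrite patchE.
  by case: (x \in A); rewrite ?mul0r ?mul0e// mul1r -EFinM mulrC.
rewrite (version_integralM sF subF vf mf f0 aX); last first.
  by move=> x; rewrite divr_ge0// ltW.
rewrite -[RHS]mul1e -(integral_cst mu mA) integral_mkcond.
apply: eq_integral => x _; rewrite patchE -EFinM mulfVK ?gt_eqF//.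
by case: (x \in A).
Qed.

Lemma cond_exp_norm_le (f : T -> R) phi_ : mu.-integrable [set: T] (EFin \o f) ->
  is_version mu F (fun x => `|f x|%R) phi_ ->
  {ae mu, forall x, forall n, `|cond_exp mu (F n) (EFin \o f) x| <= (phi_ n x)%:E}.
Proof.
move=> fi [aphi phi_0 phiE]; apply/ae_foralln => n.
have [g [mg ig gE fg]] := cond_exp_version (sF n) (@subF n) fi.
have iaf : mu.-integrable [set: T] (EFin \o (fun x => `|f x|%R)).
  exact: (integrable_norm fi).
have le1 : {ae mu, forall x, (g x)%:E <= (phi_ n x)%:E}.
  apply: (ae_le_of_integral (sF n) (@subF n) (X := EFin \o g)).
  - exact/measurable_EFinP.
  - exact: aphi.
  - move=> A k FA _; have mA := subF FA; rewrite gE// phiE//.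
    apply: le_integral => //; [exact: integrableS fi|exact: integrableS iaf|].
    by move=> x _; rewrite lee_fin ler_norm.
have le2 : {ae mu, forall x, (- g x)%:E <= (phi_ n x)%:E}.
  apply: (ae_le_of_integral (sF n) (@subF n) (X := EFin \o (fun x => - g x)%R)).
  - by apply/measurable_EFinP; exact: measurableT_comp.
  - exact: aphi.
  - move=> A k FA _; have mA := subF FA; rewrite phiE//.
    under eq_integral do rewrite /= EFinN.
    rewrite integralN; last first.
      by apply: (integrable_add_def mA); exact: integrableS ig.
    rewrite gE// -integralN; last first.
      by apply: (integrable_add_def mA); exact: integrableS fi.
    apply: le_integral => //; [|exact: integrableS iaf|].
      by apply: integrableS (integrableN fi).
    by move=> x _; rewrite -EFinN lee_fin -normrN ler_norm.
move: fg le1 le2; apply: filterS3 => x -> /=; rewrite !lee_fin => h1 h2.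
by rewrite ler_norml h1 andbT; lra.
Qed.

End versions.

(** * Reduction of the operator norm to nonnegative versions *)

Section maximal_norm_bound.
Context (d : measure_display) (T : measurableType d) (R : realType).
Variables (mu : probability T R) (F : nat -> set (set T)).
Hypotheses (sF : forall n, sigma_algebra [set: T] (F n))
  (subF : forall n, F n `<=` measurable).
Variables (p : R) (u w : T -> R).
Hypotheses (p1 : (1 < p)%R) (wu : weight mu u) (ww : weight mu w).
Hypothesis int_s : mu.-integrable [set: T] (EFin \o dual_weight p w).

Local Notation TF n := (g_sigma_algebraType (F n)).

Let p0 : (0 < p)%R. Proof. exact: lt_trans p1. Qed.

Lemma measurable_weight v : weight mu v -> measurable_fun [set: T] v.
Proof. by move=> [vi _]; apply/measurable_EFinP; exact: measurable_int vi. Qed.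

Lemma ae_weight_norm v (f g : T -> \bar R) : weight mu v ->
  measurable_fun [set: T] f -> measurable_fun [set: T] g ->
  {ae mu, forall x, f x = g x} ->
  \int[mu]_x (f x * (v x)%:E) = \int[mu]_x (g x * `|v x|%:E).
Proof.
move=> wv mf mg fg; have mv := measurable_weight wv.
apply: ae_eq_integral => //.
- by apply: emeasurable_funM => //; exact/measurable_EFinP.
- by apply: emeasurable_funM => //; apply/measurable_EFinP; exact: measurableT_comp.
- by move: wv.2 fg; apply: filterS2 => x vx -> _; rewrite gtr0_norm.
Qed.

Lemma measurable_cond_exp n (f : T -> R) : mu.-integrable [set: T] (EFin \o f) ->
  measurable_fun [set: T] (cond_exp mu (F n) (EFin \o f)).
Proof.
move=> fi; have [g [mg ig gE fg]] := cond_exp_version (sF n) (@subF n) fi.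
apply: (@Fmeas_measurable _ _ F sF subF _ _ _ n).
apply/(sub_measurable_funP (sF n)).
suff [] : is_cond_exp mu (F n) (EFin \o f) (cond_exp mu (F n) (EFin \o f)) by [].
apply: (@cond_exp_is_cond_exp _ _ _ _ _ _ (EFin \o g)); split.
  by apply/(sub_measurable_funP (sF n)); exact/measurable_EFinP.
by move=> A FA; rewrite gE.
Qed.

Lemma measurable_doob_maximal (f : T -> R) : mu.-integrable [set: T] (EFin \o f) ->
  measurable_fun [set: T] (doob_maximal mu F f).
Proof.
move=> fi; rewrite (_ : doob_maximal mu F f = fun x =>
    esups (fun n => `|cond_exp mu (F n) (EFin \o f) x|) 0%N).
  by apply: measurable_fun_esups => n; apply: measurableT_comp => //; exact: measurable_cond_exp.
by apply/funext => x; congr ereal_sup; apply/seteqP; split => _ [n _ <-]; exists n.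
Qed.

Lemma doob_maximal_ge0 (f : T -> R) x : 0 <= doob_maximal mu F f x.
Proof.
apply: (@le_trans _ _ `|cond_exp mu (F 0%N) (EFin \o f) x|) => //.
by apply: ereal_sup_ubound; exists 0%N.
Qed.

Lemma ae_doob_maximal_le (f : T -> R) phi_ : mu.-integrable [set: T] (EFin \o f) ->
  is_version mu F (fun x => `|f x|%R) phi_ ->
  {ae mu, forall x, doob_maximal mu F f x `^ p <=
    supe (fun n x => (phi_ n x `^ p)%R) x}.
Proof.
move=> fi vphi; have [_ phi_0 _] := vphi.
apply: filterS (cond_exp_norm_le sF subF fi vphi) => x h.
have B0 : 0 <= supe (fun n x => (phi_ n x `^ p)%R) x by rewrite supe_ge0// powR_ge0.
rewrite -[leRHS](poweRVK p0 B0); apply: le_poweR; [exact: ltW|exact: doob_maximal_ge0|].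
apply: ge_ereal_sup => _ [n _ <-]; apply: le_trans (h n) _.
rewrite -[leLHS](poweRKV p0) ?lee_fin//; apply: le_poweR.
- by rewrite invr_ge0 ltW.
- by rewrite poweR_ge0.
- by rewrite poweR_EFin; exact: (le_supe (fun n x => (phi_ n x `^ p)%R)).
Qed.

Lemma weighted_Lp_integrable (f : T -> R) : weighted_Lp mu p w f ->
  \int[mu]_x (`|f x| `^ p * `|w x|)%:E < +oo /\ mu.-integrable [set: T] (EFin \o f).
Proof.
move=> [mf nf].
have mw := measurable_weight ww.
have mfp : measurable_fun [set: T] (fun x => (`|f x| `^ p)%R).
  by apply: (measurableT_comp (measurable_powR p)); exact: measurableT_comp.
have mfw : measurable_fun [set: T] (fun x => (`|f x| `^ p * `|w x|)%R).
  by apply: measurable_funM => //; exact: measurableT_comp.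
have fw : \int[mu]_x (`|f x| `^ p * `|w x|)%:E < +oo.
  have pV : (p^-1 != 0)%R by rewrite invr_eq0 gt_eqF.
  move: nf => /(lty_poweRy pV).
  rewrite (@ae_weight_norm _ _ (fun x => (`|f x| `^ p)%:E) ww)//.
  - apply: (measurableT_comp (measurable_poweR p)).
    by apply: measurableT_comp => //; exact/measurable_EFinP.
  - exact/measurable_EFinP.
  - by apply: aeW => x /=.
split => //; apply/integrableP; split; first exact/measurable_EFinP.
apply: (@le_lt_trans _ _ (\int[mu]_x ((`|f x| `^ p * `|w x|)%:E + (dual_weight p w x)%:E))).
  apply: ae_ge0_le_integral => //.
  - by apply: measurableT_comp => //; exact/measurable_EFinP.
  - by move=> x _; rewrite -EFinD lee_fin addr_ge0 ?mulr_ge0 ?powR_ge0.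
  - by apply: emeasurable_funD; [exact/measurable_EFinP|exact: measurable_int int_s].
  - apply: filterS ww.2 => x wx _; rewrite -EFinD /= lee_fin (gtr0_norm wx).
    exact: le_powR_dual.
rewrite ge0_integralD//.
- by rewrite lte_add_pinfty//; exact: (integrable_lty measurableT int_s).
- exact/measurable_EFinP.
- by move=> x _; rewrite lee_fin powR_ge0.
- exact: measurable_int int_s.
Qed.

(** Reduction to [phi = |f|], using $|\mathbb E_n f|\le\phi_n$ a.e. and p-th powers of norms.
    Replacing weights by their absolute values and [cond_exp] of [f] by versions is settled here
    once. *)
Lemma maximal_norm_le (c : R) : (0 <= c)%R ->
  (forall (phi : T -> R) phi_, measurable_fun [set: T] phi ->
    (forall x, (0 <= phi x)%R) -> mu.-integrable [set: T] (EFin \o phi) ->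
    is_version mu F phi phi_ -> \int[mu]_x (phi x `^ p * `|w x|)%:E < +oo ->
    \int[mu]_x (supe (fun n x => (phi_ n x `^ p)%R) x * `|u x|%:E) <=
    c%:E * \int[mu]_x (phi x `^ p * `|w x|)%:E) ->
  maximal_norm mu F p w u <= (c `^ p^-1)%:E.
Proof.
move=> c0 H; apply: ereal_inf_lbound; exists (c `^ p^-1)%R => //=.
split; first exact: powR_ge0.
move=> f fLp; have [fw fi] := weighted_Lp_integrable fLp.
have mf := fLp.1; have mw := measurable_weight ww; have mu' := measurable_weight wu.
have iaf : mu.-integrable [set: T] (EFin \o (fun x => `|f x|%R)).
  exact: (integrable_norm fi).
have maf : measurable_fun [set: T] (fun x => `|f x|%R) by exact: measurableT_comp.
have [phi_ [vphi _]] := exists_version sF subF iaf (fun x => normr_ge0 _).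
have [aphi phi_0 _] := vphi.
have {}H := H _ _ maf (fun x => normr_ge0 _) iaf vphi fw.
have mdp : measurable_fun [set: T] (fun x => `|doob_maximal mu F f x| `^ p).
  apply: (measurableT_comp (measurable_poweR p)); apply: measurableT_comp => //.
  exact: measurable_doob_maximal.
have msp : measurable_fun [set: T] (supe (fun n x => (phi_ n x `^ p)%R)).
  apply: measurable_supe => n; apply: (measurableT_comp (measurable_powR p)).
  exact: (Fmeas_measurable sF subF (@aphi n)).
have mEu : measurable_fun [set: T] (fun x => `|u x|%:E).
  by apply/measurable_EFinP; exact: measurableT_comp.
rewrite /weighted_norm (@ae_weight_norm u _ _ wu mdp mdp); last exact: aeW.
rewrite (@ae_weight_norm w _ (fun x => (`|f x| `^ p)%:E) ww); last 3 first.
- apply: (measurableT_comp (measurable_poweR p)).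
  by apply: measurableT_comp => //; exact/measurable_EFinP.
- by apply/measurable_EFinP; exact: (measurableT_comp (measurable_powR p)).
- by apply: aeW => x /=.
rewrite -poweR_EFin -poweRM ?lee_fin//; last first.
  by apply: integral_ge0 => x _; rewrite lee_fin mulr_ge0 ?powR_ge0.
apply: le_poweR; first by rewrite invr_ge0 ltW.
  by apply: integral_ge0 => x _; rewrite mule_ge0 ?lee_fin ?poweR_ge0.
apply: le_trans H; apply: ae_ge0_le_integral => //.
- by move=> x _; rewrite mule_ge0 ?lee_fin ?poweR_ge0.
- exact: emeasurable_funM.
- by move=> x _; rewrite mule_ge0 ?lee_fin// supe_ge0// powR_ge0.
- exact: emeasurable_funM.
- apply: filterS (ae_doob_maximal_le fi vphi) => x h _.
  by rewrite lee_wpmul2r ?lee_fin// gee0_abs// doob_maximal_ge0.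
Qed.

End maximal_norm_bound.

Lemma powR_ratio (R : realType) (p f s v : R) : (0 < p)%R -> (0 <= f)%R -> (0 < s)%R ->
  (f `^ p * v = (f / s) `^ p * s * (v * s `^ (p - 1)))%R.
Proof.
move=> p0 f0 s0; have fs0 : (0 <= f / s)%R by rewrite divr_ge0// ltW.
have -> : (f `^ p = (f / s) `^ p * s `^ p)%R.
  by rewrite -(powRM _ fs0 (ltW s0)) divfK// gt_eqF.
by rewrite -(mulr_powRB1 (ltW s0) p0); ring.
Qed.

(** * The tail maximal function *)

Section tail_maximal_theory.
Context (d : measure_display) (T : measurableType d) (R : realType).
Variables (mu : probability T R) (F : nat -> set (set T)).
Hypotheses (sF : forall n, sigma_algebra [set: T] (F n))
  (subF : forall n, F n `<=` measurable).
Variable f : T -> R.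

Lemma tail_maximal_ge0 n x : 0 <= tail_maximal mu F n f x.
Proof.
apply: (@le_trans _ _ `|cond_exp mu (F n) (EFin \o f) x|) => //.
by apply: ereal_sup_ubound; exists n => //=.
Qed.

Lemma measurable_tail_maximal n : mu.-integrable [set: T] (EFin \o f) ->
  measurable_fun [set: T] (tail_maximal mu F n f).
Proof.
move=> fi; rewrite (_ : tail_maximal mu F n f = fun x =>
    esups (fun n => `|cond_exp mu (F n) (EFin \o f) x|) n)//.
apply: measurable_fun_esups => k; apply: measurableT_comp => //.
exact: (measurable_cond_exp sF subF).
Qed.

Lemma ae_version_le_tail (f_ : nat -> T -> R) :
  (forall n, {ae mu, forall x, cond_exp mu (F n) (EFin \o f) x = (f_ n x)%:E}) ->
  {ae mu, forall x k n, (k <= n)%N -> (f_ n x)%:E <= tail_maximal mu F k f x}.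
Proof.
move=> fE; have : {ae mu, forall x n, cond_exp mu (F n) (EFin \o f) x = (f_ n x)%:E}.
  exact/ae_foralln.
apply: filterS => x h k n kn; rewrite -h; apply: le_trans (lee_abs _) _.
by apply: ereal_sup_ubound; exists n.
Qed.

End tail_maximal_theory.

(** * Bound by slices of the A_p quantity *)

Section sliced_bound.
Context (d : measure_display) (T : measurableType d) (R : realType).
Variables (mu : probability T R) (F : nat -> set (set T)).
Hypotheses (sF : forall n, sigma_algebra [set: T] (F n))
  (subF : forall n, F n `<=` measurable)
  (incF : forall m n, (m <= n)%N -> F m `<=` F n).
Variables (p : R) (u w : T -> R).
Hypotheses (p1 : (1 < p)%R) (wu : weight mu u) (ww : weight mu w).
Hypothesis int_s : mu.-integrable [set: T] (EFin \o dual_weight p w).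
Variables (u_ s_ : nat -> T -> R).
Hypothesis vu : is_version mu F (fun x => `|u x|%R) u_.
Hypotheses (vs : is_version mu F (dual_weight p w) s_)
  (s_gt0 : forall n x, (0 < s_ n x)%R).
Hypothesis sE : forall n,
  {ae mu, forall x, cond_exp mu (F n) (EFin \o dual_weight p w) x = (s_ n x)%:E}.

Local Notation TF n := (g_sigma_algebraType (F n)).
Local Notation sigma := (dual_weight p w).

Let p0 : (0 < p)%R. Proof. exact: lt_trans p1. Qed.
Let ms : measurable_fun [set: T] sigma.
Proof. by apply/measurable_EFinP; exact: measurable_int int_s. Qed.
Let s0 x : (0 <= sigma x)%R. Proof. exact: powR_ge0. Qed.

Variables (J : nat) (K A : nat -> R) (Q : nat -> nat -> set T).
Hypotheses (K0 : forall j, (0 <= K j)%R) (A0 : forall j, (0 <= A j)%R).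
Hypothesis FQ : forall j n, F n (Q j n).
Hypothesis tailA : forall j n B, F n B -> B `<=` Q j n ->
  \int[mu]_(x in B) tail_maximal mu F n sigma x <=
  (A j)%:E * \int[mu]_(x in B) (sigma x)%:E.
Hypothesis uK : forall n, {ae mu, forall x,
  (u_ n x * s_ n x `^ (p - 1) <= \sum_(j < J) K j * (x \in Q j n)%:R)%R}.

(** Common form of the second and third bounds: [K j] controls the A_p quantity on the slice [Q j],
    and [A j] the tail maximal function there. Each slice is a Carleson embedding for $x_n^p$ cut to
    [Q j n], followed by Doob's inequality. *)
Lemma maximal_norm_sliced : maximal_norm mu F p w u <=
  ((2 `^ p * 2 * doob_cst p * \sum_(j < J) K j * A j) `^ p^-1)%:E.
Proof.
have D0 := doob_cst_ge0 p1.
have KA0 : (0 <= \sum_(j < J) K j * A j)%R by apply: sumr_ge0 => j _; rewrite mulr_ge0.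
apply: (maximal_norm_le sF subF p1 wu ww int_s).
  by apply: mulr_ge0 => //; apply: mulr_ge0 => //; apply: mulr_ge0.
move=> phi phi_ mphi phi0 iphi vphi phiw.
have [aphi phi_0 _] := vphi; have [as_ s_0 _] := vs.
pose z j n x : R := ((x \in Q j n)%:R * (phi_ n x / s_ n x) `^ p)%R.
have ax : adapted F (fun n x => ((phi_ n x / s_ n x) `^ p)%R).
  move=> n; apply: (measurableT_comp (measurable_powR p)).
  by apply: (@measurable_fun_div _ (TF n)); [exact: aphi|exact: as_|].
have az j : adapted F (z j).
  move=> n; apply: measurable_funM; last exact: ax.
  by apply: Fmeas_natr; exact: (Fmeas_pred sF).
have z0 j n x : (0 <= z j n x)%R by rewrite mulr_ge0 ?powR_ge0.
pose Z j n x : R := (z j n x * s_ n x)%R.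
have aZ j : adapted F (Z j).
  by move=> n; apply: measurable_funM; [exact: az|exact: as_].
have mau : measurable_fun [set: T] (fun x => `|u x|%R).
  by apply: measurableT_comp => //; exact: measurable_weight wu.
have mw : measurable_fun [set: T] w by exact: measurable_weight ww.
have H := @integral_supe_powR_le _ _ _ _ _ sF subF incF _ _ mphi phi0 vphi p _ _ J K Z
  p0 mau (fun x => normr_ge0 _) vu K0 aZ.
apply: le_trans (H _ _ _) _.
- by move=> j n x; rewrite mulr_ge0.
- by move=> j n x phi_x; rewrite /Z /z phi_x mul0r powR0 ?gt_eqF// mulr0 mul0r.
- move=> n; apply: filterS (uK n) => x h.
  rewrite (powR_ratio _ p0 (phi_0 n x) (s_gt0 n x)).
  apply: le_trans (ler_wpM2l _ h) _; first by rewrite mulr_ge0 ?powR_ge0.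
  rewrite mulr_sumr; apply: ler_sum => j _; rewrite /Z /z.
  by rewrite le_eqVlt; apply/orP; left; apply/eqP; ring.
have doob := doob_weighted sF subF incF p1 mw ww.2 int_s vs s_gt0 mphi phi0 vphi.
set I := \int[mu]_x (phi x `^ p * `|w x|)%:E in doob phiw *.
have I0 : 0 <= I by apply: integral_ge0 => x _; rewrite lee_fin mulr_ge0 ?powR_ge0.
have mx : measurable_fun [set: T] (supe (fun n x => ((phi_ n x / s_ n x) `^ p)%R)).
  by apply: measurable_supe => n; exact: (Fmeas_measurable sF subF (@ax n)).
have slice j : \int[mu]_x supe (Z j) x <= (A j)%:E * ((doob_cst p)%:E * I).
  apply: (@le_trans _ _ ((A j)%:E * \int[mu]_x (supe (z j) x * (sigma x)%:E))).
    apply: (@integral_supeM_le _ _ _ mu F sF subF incF (z j) (Q j)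
      (fun n => tail_maximal mu F n sigma)) => //.
    - move=> n x nQ; rewrite /z; case: (boolP (x \in Q j n)) => [/set_mem//|_].
      by rewrite mul0r.
    - by move=> n; exact: measurable_tail_maximal.
    - by move=> n x; exact: tail_maximal_ge0.
    - exact: tailA.
    - by move=> n; exact: (Fmeas_measurable sF subF (@as_ n)).
    - exact: ae_version_le_tail.
  apply: lee_wpmul2l; first by rewrite lee_fin.
  apply: le_trans doob; apply: ge0_le_integral => //.
  - by move=> x _; rewrite mule_ge0 ?lee_fin// supe_ge0.
  - apply: emeasurable_funM; last exact/measurable_EFinP.
    by apply: measurable_supe => n; exact: (Fmeas_measurable sF subF (@az j n)).
  - by apply: emeasurable_funM => //; exact/measurable_EFinP.
  - move=> x _; rewrite lee_wpmul2r ?lee_fin//; apply: supe_le => n.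
    apply: le_trans (le_supe (fun n x => ((phi_ n x / s_ n x) `^ p)%R) n x).
    rewrite lee_fin /z; case: (x \in _); rewrite ?mul1r//.
    by rewrite mul0r powR_ge0.
have -> : (2 `^ p * 2 * doob_cst p * (\sum_(j < J) K j * A j))%:E * I =
    (2 `^ p * 2)%:E * \sum_(j < J) (K j)%:E * ((A j)%:E * ((doob_cst p)%:E * I)).
  have -> : \sum_(j < J) (K j)%:E * ((A j)%:E * ((doob_cst p)%:E * I)) =
      (\sum_(j < J) (K j * A j)%:E) * ((doob_cst p)%:E * I).
    rewrite ge0_sume_distrl; first by apply: eq_bigr => j _; rewrite EFinM muleA.
    by move=> j _; rewrite lee_fin mulr_ge0.
  rewrite sumEFin !muleA -!EFinM; congr (_%:E * _); ring.
apply: lee_wpmul2l; first by rewrite lee_fin mulr_ge0 ?powR_ge0.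
by apply: lee_sum => j _; apply: lee_wpmul2l; rewrite ?lee_fin.
Qed.

End sliced_bound.

(** * From weight constants to the packing condition *)

Section tail_bounds.
Context (d : measure_display) (T : measurableType d) (R : realType).
Variables (mu : probability T R) (F : nat -> set (set T)).
Hypotheses (sF : forall n, sigma_algebra [set: T] (F n))
  (subF : forall n, F n `<=` measurable).
Variables (f : T -> R) (f_ : nat -> T -> R).
Hypothesis fi : mu.-integrable [set: T] (EFin \o f).
Hypotheses (vf : is_version mu F f f_) (f_gt0 : forall n x, (0 < f_ n x)%R).
Hypothesis fE : forall n,
  {ae mu, forall x, cond_exp mu (F n) (EFin \o f) x = (f_ n x)%:E}.

Local Notation TF n := (g_sigma_algebraType (F n)).

Lemma integral_le_funepos (D : set T) (g : T -> \bar R) :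
  measurable D -> measurable_fun D g ->
  \int[mu]_(x in D) g x <= \int[mu]_(x in D) g^\+ x.
Proof.
move=> mD mg; rewrite integralE geeDl// oppe_le0; apply: integral_ge0 => x _.
exact: funeneg_ge0.
Qed.

Let mf_ n : measurable_fun [set: T] (f_ n).
Proof. by have [af _ _] := vf; exact: (Fmeas_measurable sF subF (@af n)). Qed.

(** The chosen [cond_exp] need not be nonnegative at every point, so its positive part is
    estimated. *)
Lemma tail_le_Ainfty n (C : R) (B : set T) : (0 <= C)%R ->
  {ae mu, forall x, cond_exp mu (F n) (tail_maximal mu F n f) x <=
    C%:E * cond_exp mu (F n) (EFin \o f) x} -> F n B ->
  \int[mu]_(x in B) tail_maximal mu F n f x <= C%:E * \int[mu]_(x in B) (f x)%:E.
Proof.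
move=> C0 h FB; have mB := subF FB; have [_ f_0 f_E] := vf.
have [me <-//] := ge0_cond_expP mu (sF n) (@subF n)
  (measurable_tail_maximal sF subF n fi) (tail_maximal_ge0 mu F f n).
have me' : measurable_fun [set: T] (cond_exp mu (F n) (tail_maximal mu F n f)).
  by apply: (Fmeas_measurable (n := n) sF subF); exact/(sub_measurable_funP (sF n)).
apply: le_trans (integral_le_funepos mB _) _; first exact: measurable_funTS.
rewrite -(f_E n)// -ge0_integralZl//; last 2 first.
- exact/measurable_funTS/measurable_EFinP.
- by move=> x _; rewrite lee_fin.
apply: ae_ge0_le_integral => //.
- exact/measurable_funTS/measurable_funepos.
- by move=> x _; rewrite mule_ge0 ?lee_fin.
- by apply: measurable_funeM; exact/measurable_funTS/measurable_EFinP.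
- move: h (fE n); apply: filterS2 => x hx fx _; rewrite fx in hx.
  by rewrite funeposE ge_max hx mule_ge0 ?lee_fin.
Qed.

(** Multiplying by $1_B f_n$, known at time [n], undoes the division inside the conditional
    expectation. *)
Lemma tail_le_ratio n (C : R) (B : set T) :
  measure_is_complete mu -> (0 <= C)%R ->
  {ae mu, forall x, B x -> cond_exp mu (F n) (fun y => tail_maximal mu F n f y /
    cond_exp mu (F n) (EFin \o f) y) x <= C%:E} -> F n B ->
  \int[mu]_(x in B) tail_maximal mu F n f x <= C%:E * \int[mu]_(x in B) (f x)%:E.
Proof.
move=> cmu C0 h FB; have mB := subF FB; have [af f_0 f_E] := vf.
have mt := measurable_tail_maximal sF subF n fi.
pose r x := tail_maximal mu F n f x * ((f_ n x)^-1)%:E.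
have r0 x : 0 <= r x by rewrite mule_ge0 ?tail_maximal_ge0 ?lee_fin ?invr_ge0.
have mr : measurable_fun [set: T] r.
  apply: emeasurable_funM => //; apply/measurable_EFinP.
  rewrite (_ : (fun _ => _) = (fun x => 1 / f_ n x)%R).
    by apply: measurable_fun_div => // x; exact: ltW.
  by apply/funext => x; rewrite div1r.
have rE : {ae mu, forall x, r x =
    tail_maximal mu F n f x / cond_exp mu (F n) (EFin \o f) x}.
  by apply: filterS (fE n) => x ->; rewrite inver gt_eqF.
(* The quotient divides by the chosen [cond_exp] and not by the version [f_]; its measurability
   comes from a.e. equality with [r] and completeness of [mu]. *)
move: h; rewrite -(@eq_cond_exp _ _ _ _ _ (@subF n) r)//; last first.
  by apply: (ae_measurable_fun cmu _ mr); apply: filterS rE => x /= ->.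
move=> h; set e := cond_exp mu (F n) r in h.
have [me eE] := ge0_cond_expP mu (sF n) (@subF n) mr r0.
have me' : measurable_fun [set: T] e.
  by apply: (Fmeas_measurable (n := n) sF subF); exact/(sub_measurable_funP (sF n)).
pose X x : R := ((x \in B)%:R * f_ n x)%R.
have X0 x : (0 <= X x)%R by rewrite mulr_ge0.
have aX : measurable_fun [set: TF n] (X : TF n -> R).
  by apply: measurable_funM; [apply: Fmeas_natr; exact: (Fmeas_pred sF)|exact: af].
have -> : \int[mu]_(x in B) tail_maximal mu F n f x = \int[mu]_x ((X x)%:E * r x).
  rewrite integral_mkcond; apply: eq_integral => x _; rewrite patchE /X /r.
  case: (x \in B); rewrite ?mul0r ?mul0e// mul1r muleCA -EFinM.
  by rewrite mulfV ?gt_eqF// mule1.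
apply: (@le_trans _ _ (\int[mu]_x ((X x)%:E * e^\+ x))).
  apply: (le_integralM_sub (sF n) (@subF n)) => //.
  - exact: measurable_funepos.
  - move=> D FD; have mD := subF FD; rewrite -eE//.
    by apply: integral_le_funepos => //; exact: measurable_funTS.
rewrite -(f_E n)// -ge0_integralZl//; last 2 first.
- exact/measurable_funTS/measurable_EFinP.
- by move=> x _; rewrite lee_fin.
rewrite [leRHS]integral_mkcond; apply: ae_ge0_le_integral => //.
- by move=> x _; rewrite mule_ge0 ?lee_fin.
- apply: emeasurable_funM; last exact: measurable_funepos.
  by apply/measurable_EFinP; exact: (Fmeas_measurable (n := n) sF subF).
- by move=> x _; apply: erestrict_ge0 => y _; rewrite mule_ge0 ?lee_fin.
- apply/(measurable_restrictT _ mB)/measurable_funTS/measurable_funeM.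
  exact/measurable_EFinP.
- apply: filterS h => x h _; rewrite patchE /X; case: (boolP (x \in B)) => xB.
    rewrite mul1r muleC lee_wpmul2r ?lee_fin// funeposE ge_max lee_fin C0 andbT.
    by apply: h; exact: set_mem.
  by rewrite mul0r mul0e.
Qed.

End tail_bounds.

(** * Conditional Jensen inequalities *)

(** [ln f = 2 ln (f^(1/2))], and [ln] lies below its tangent at [c]. When [c] is the conditional
    expectation of [f^(1/2)], the last term averages to 0. *)
Lemma ln_le_tangent (R : realType) (f c : R) : (0 < f)%R -> (0 < c)%R ->
  (ln f <= 2 * ln c + 2 * (f `^ 2^-1 / c - 1))%R.
Proof.
move=> f0 c0; have r0 : (0 < f `^ 2^-1)%R by exact: powR_gt0.
have rc0 : (0 < f `^ 2^-1 / c)%R by rewrite divr_gt0.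
have := @le_ln1Dx _ (f `^ 2^-1 / c - 1)%R.
rewrite (_ : 1 + (f `^ 2^-1 / c - 1) = f `^ 2^-1 / c)%R; last by ring.
rewrite ln_div ?posrE// ln_powR => h.
by have {}h := h (ltac:(lra)); lra.
Qed.

Section conditional_jensen.
Context (d : measure_display) (T : measurableType d) (R : realType).
Variables (mu : probability T R) (F : nat -> set (set T)).
Hypotheses (sF : forall n, sigma_algebra [set: T] (F n))
  (subF : forall n, F n `<=` measurable).

Local Notation TF n := (g_sigma_algebraType (F n)).

(** [dual_weight_young] with [a = w_n] and [s = s_n], averaged: its right side becomes
    [1/p + (1 - 1/p) = 1]. This is why the dyadic slices may start at [j = 0]. *)
Lemma version_Ap_ge1 (p : R) (w : T -> R) (w_ s_ : nat -> T -> R) n :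
  (1 < p)%R -> weight mu w ->
  mu.-integrable [set: T] (EFin \o dual_weight p w) ->
  is_version mu F (fun x => `|w x|%R) w_ -> (forall n x, (0 < w_ n x)%R) ->
  is_version mu F (dual_weight p w) s_ -> (forall n x, (0 < s_ n x)%R) ->
  {ae mu, forall x, (1 <= w_ n x * s_ n x `^ (p - 1))%R}.
Proof.
move=> p1 ww int_s vw w_0 vs s_0.
have [aw _ _] := vw; have [as_ _ _] := vs.
have p0 : (0 < p)%R by lra.
have pV0 : (0 < p^-1)%R by rewrite invr_gt0.
have pV1 : (0 <= 1 - p^-1)%R by rewrite subr_ge0 invf_le1// ltW.
have mw := measurable_weight ww.
have maw : measurable_fun [set: T] (fun x => `|w x|%R) by exact: measurableT_comp.
have ms : measurable_fun [set: T] (dual_weight p w).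
  by apply/measurable_EFinP; exact: measurable_int int_s.
have mw_ : measurable_fun [set: T] (w_ n) by exact: (Fmeas_measurable sF subF (@aw n)).
have ms_ : measurable_fun [set: T] (s_ n) by exact: (Fmeas_measurable sF subF (@as_ n)).
pose X x : R := ((w_ n x * s_ n x `^ (p - 1)) `^ (- p^-1))%R.
have aX : measurable_fun [set: TF n] (X : TF n -> R).
  apply: (measurableT_comp (measurable_powR (- p^-1))).
  apply: measurable_funM; first exact: aw.
  by apply: (measurableT_comp (measurable_powR (p - 1))); exact: as_.
have X1 : {ae mu, forall x, (X x)%:E <= 1%:E}.
  apply: (ae_le_of_integral (sF n) (@subF n) (X := EFin \o X) (y := cst 1%R)).
  - exact/measurable_EFinP.
  - exact: measurable_cst.
  - move=> A k FA _; have mA := subF FA.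
    pose f1 x := (`|w x| / w_ n x)%:E; pose f2 x := (dual_weight p w x / s_ n x)%:E.
    have f10 x : 0 <= f1 x by rewrite lee_fin divr_ge0// ltW.
    have f20 x : 0 <= f2 x by rewrite lee_fin divr_ge0 ?powR_ge0// ltW.
    have mf1 : measurable_fun A f1.
      apply/measurable_funTS/measurable_EFinP; apply: measurable_fun_div => //.
      by move=> x; exact: ltW.
    have mf2 : measurable_fun A f2.
      apply/measurable_funTS/measurable_EFinP; apply: measurable_fun_div => //.
      by move=> x; exact: ltW.
    apply: (@le_trans _ _ (\int[mu]_(x in A)
        (p^-1%:E * f1 x + (1 - p^-1)%:E * f2 x))).
      apply: ae_ge0_le_integral => //.
      + by move=> x _; rewrite lee_fin powR_ge0.
      + apply/measurable_funTS/measurable_EFinP.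
        exact: (Fmeas_measurable (n := n) sF subF).
      + by move=> x _; rewrite adde_ge0// mule_ge0// lee_fin// ltW.
      + by apply: emeasurable_funD; exact: measurable_funeM.
      + apply: filterS ww.2 => x wx _; rewrite /f1 /f2 -!EFinM -EFinD lee_fin.
        rewrite (gtr0_norm wx); exact: dual_weight_young.
    rewrite ge0_integralD//.
    + rewrite !ge0_integralZl// ?lee_fin ?(ltW pV0)//.
      rewrite /f1 /f2 (integral_version_div sF subF vw)//.
      rewrite (integral_version_div sF subF vs)//; last by move=> x; exact: powR_ge0.
      rewrite -ge0_muleDl ?lee_fin ?(ltW pV0)// -EFinD addrC subrK mul1e.
      by have := integral_cst mu mA 1%E; rewrite mul1e => <-.
    + by move=> x _; rewrite mule_ge0// lee_fin ltW.
    + exact: measurable_funeM.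
    + by move=> x _; rewrite mule_ge0.
    + exact: measurable_funeM.
apply: filterS X1 => x; rewrite lee_fin /X powRN.
have v0 : (0 < w_ n x * s_ n x `^ (p - 1))%R by rewrite mulr_gt0 ?powR_gt0.
move: (w_ n x * _)%R v0 => v v0; rewrite invf_le1 ?powR_gt0// => h.
have : (1 `^ p <= (v `^ p^-1) `^ p)%R.
  by apply: ge0_ler_powR; rewrite ?nnegrE ?powR_ge0 ?(ltW p0).
by rewrite powR1 -powRrM mulVf ?gt_eqF// powRr1// ltW.
Qed.

(** Conditional Jensen, by integrating the tangent inequality at [c = c_n]. Neither logarithm is
    known to be integrable, so the comparison is tested on sets where [ln c_n] is bounded. *)
Lemma cond_exp_ln_le (f : T -> R) (c_ : nat -> T -> R) n :
  mu.-integrable [set: T] (EFin \o f) -> (forall x, (0 <= f x)%R) ->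
  {ae mu, forall x, (0 < f x)%R} ->
  is_version mu F (fun x => (f x `^ 2^-1)%R) c_ -> (forall n x, (0 < c_ n x)%R) ->
  {ae mu, forall x, cond_exp mu (F n) (fun y => (ln (f y))%:E) x <=
    (2 * ln (c_ n x))%:E}.
Proof.
move=> fi f0 fp vc c_0; have [ac _ _] := vc.
have mf : measurable_fun [set: T] f by apply/measurable_EFinP; exact: measurable_int fi.
have mlf : measurable_fun [set: T] (fun x => ln (f x)).
  exact: (measurableT_comp (@measurable_ln R)).
have lnf x : (ln (f x) <= f x)%R.
  have := f0 x; rewrite le_eqVlt => /predU1P[<-|fx]; first by rewrite ln0.
  exact/ltW/ln_sublinear.
have [mX XE] := cond_exp_leP (sF n) (@subF n) mlf fi lnf.
have ay : measurable_fun [set: TF n] (fun x : TF n => (2 * ln (c_ n x))%R).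
  by apply: measurable_funM => //; apply: (measurableT_comp (@measurable_ln R)); exact: ac.
have my : measurable_fun [set: T] (fun x => (2 * ln (c_ n x))%R).
  exact: (Fmeas_measurable (n := n) sF subF).
have mc : measurable_fun [set: T] (c_ n) by exact: (Fmeas_measurable sF subF (@ac n)).
have mr : measurable_fun [set: T] (fun x => (f x `^ 2^-1)%R).
  exact: (measurableT_comp (measurable_powR _)).
apply: (ae_le_of_integral (sF n) (@subF n)) => //.
  exact/(sub_measurable_funP (sF n)).
move=> A k FA yk; have mA := subF FA; rewrite XE//.
pose y x : R := (2 * ln (c_ n x))%R.
pose r x : R := (f x `^ 2^-1 / c_ n x)%R.
pose t x : R := (2 * r x - 2)%R.
have r0 x : (0 <= r x)%R by rewrite divr_ge0 ?powR_ge0// ltW.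
have mr' : measurable_fun [set: T] r.
  by apply: measurable_fun_div => // x; exact: ltW.
have mE (g : T -> R) : measurable_fun [set: T] g -> measurable_fun A (EFin \o g).
  by move=> ?; exact/measurable_funTS/measurable_EFinP.
have muAfin : mu A \is a fin_num by exact: fin_num_measure.
have rE : \int[mu]_(x in A) (r x)%:E = mu A.
  by apply: (integral_version_div sF subF vc) => // x; exact: powR_ge0.
have ir : mu.-integrable A (EFin \o r).
  apply/integrableP; split; first exact: mE.
  rewrite (_ : \int[mu]_(x in A) _ = mu A) ?ltey_eq ?muAfin//.
  by rewrite -rE; apply: eq_integral => x _ /=; rewrite ger0_norm.
have iy : mu.-integrable A (EFin \o y).
  apply: (le_integrable mA (mE _ my) (g := cst k%:E)).
    by move=> x Ax; rewrite /= lee_fin (le_trans (yk x Ax))// ler_norm.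
  exact: finite_measure_integrable_cst.
have i2 : mu.-integrable A (EFin \o (cst 2%R : T -> R)).
  exact: finite_measure_integrable_cst.
have i2r : mu.-integrable A (EFin \o (fun x => 2 * r x)%R).
  exact: (integrableZl mA 2%R ir).
have it : mu.-integrable A (EFin \o t) by exact: (integrableB mA i2r i2).
have tE : \int[mu]_(x in A) (t x)%:E = 0.
  rewrite (_ : \int[mu]_(x in A) (t x)%:E =
    \int[mu]_(x in A) (2 * r x)%:E - \int[mu]_(x in A) (cst 2%R x : R)%:E).
    under eq_integral do rewrite EFinM.
    rewrite ge0_integralZl//; [|exact: mE|by move=> x _; rewrite lee_fin].
    rewrite rE (_ : \int[mu]_(x in A) _ = 2%:E * mu A).
      by rewrite subee// fin_numM.
    exact: (integral_cst mu mA 2%:E).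
  exact: (integralB mA i2r i2).
have iyt : mu.-integrable A (EFin \o (fun x => y x + t x)%R).
  exact: (integrableD mA iy it).
(* The gap in the tangent inequality, cut at 0 so that it is nonnegative also on the null set where
   [f] vanishes. *)
pose b x := (Num.max (y x + t x - ln (f x)) 0)%:E.
have mb : measurable_fun A b.
  apply: mE; apply: measurable_maxr => //; apply: measurable_funB => //.
  apply: measurable_funD => //; apply: measurable_funB => //.
  exact: measurable_funM.
have b0 x : 0 <= b x by rewrite lee_fin le_max lexx orbT.
have -> : \int[mu]_(x in A) (ln (f x))%:E = \int[mu]_(x in A) ((y x + t x)%:E - b x).
  apply: ae_eq_integral => //; first exact: (mE _ mlf).
    by apply: emeasurable_funB => //; exact: (measurable_int mu iyt).
  apply: filterS fp => x fx _; rewrite /b max_l; first by rewrite -EFinB; congr _%:E; ring.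
  have := ln_le_tangent fx (c_0 n x); rewrite /y /t /r; lra.
rewrite integral_ge0Bl//.
apply: (@le_trans _ _ (\int[mu]_(x in A) (y x + t x)%:E)).
  by rewrite geeDl// oppe_le0; apply: integral_ge0.
rewrite (_ : \int[mu]_(x in A) (y x + t x)%:E =
  \int[mu]_(x in A) (y x)%:E + \int[mu]_(x in A) (t x)%:E).
  by rewrite tE adde0.
exact: (integralD mA iy it).
Qed.

End conditional_jensen.

Lemma powR_half_le (R : realType) (a : R) : (0 <= a)%R -> (a `^ 2^-1 <= 1 + a)%R.
Proof.
move=> a0; have [a1|/ltW a1] := leP a 1%R.
  apply: (@le_trans _ _ (1 `^ 2^-1)%R); last by rewrite powR1; lra.
  by apply: ge0_ler_powR; rewrite ?nnegrE ?invr_ge0.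
by have := @ler1_powR _ a 2^-1 a1 (ltac:(lra)); lra.
Qed.

Lemma powR_half_sqr (R : realType) (a : R) : (0 <= a)%R -> ((a `^ 2^-1) ^+ 2 = a)%R.
Proof. by move=> a0; rewrite powR12_sqrt// sqr_sqrtr. Qed.

(** * The B_p bound *)

Section Bp_bound_theory.
Context (d : measure_display) (T : measurableType d) (R : realType).
Variables (mu : probability T R) (F : nat -> set (set T)).
Hypotheses (sF : forall n, sigma_algebra [set: T] (F n))
  (subF : forall n, F n `<=` measurable)
  (incF : forall m n, (m <= n)%N -> F m `<=` F n).

Local Notation TF n := (g_sigma_algebraType (F n)).

Lemma integrable_powR_half (f : T -> R) : measurable_fun [set: T] f ->
  (forall x, (0 <= f x)%R) -> mu.-integrable [set: T] (EFin \o f) ->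
  mu.-integrable [set: T] (EFin \o (fun x => (f x `^ 2^-1)%R)).
Proof.
move=> mf f0 fi.
apply: (le_integrable measurableT (g := EFin \o (fun x => 1 + f x)%R)).
- by apply/measurable_EFinP; exact: (measurableT_comp (measurable_powR _)).
- move=> x _; rewrite /= lee_fin !ger0_norm ?powR_ge0 ?addr_ge0//.
  exact: powR_half_le.
- have i1 : mu.-integrable [set: T] (EFin \o (cst 1%R : T -> R)).
    exact: finite_measure_integrable_cst.
  exact: (integrableD measurableT i1 fi).
Qed.

(** The case of exponent 2 and weight 1 of [doob_weighted]: the dual weight and its versions are all
    1. *)
Lemma doob_L2 (h : T -> R) h_ : measurable_fun [set: T] h ->
  (forall x, (0 <= h x)%R) -> is_version mu F h h_ ->
  \int[mu]_x supe (fun n x => (h_ n x ^+ 2)%R) x <=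
  (doob_cst (2 : R))%:E * \int[mu]_x (h x ^+ 2)%:E.
Proof.
move=> mh h0 vh; have [_ h_0 _] := vh.
have dE : dual_weight 2 (cst 1%R : T -> R) = cst 1%R.
  by apply/funext => x; rewrite /dual_weight powR1.
have i1 : mu.-integrable [set: T] (EFin \o dual_weight 2 (cst 1%R : T -> R)).
  by rewrite dE; exact: finite_measure_integrable_cst.
have v1 : is_version mu F (dual_weight 2 (cst 1%R : T -> R)) (fun=> cst 1%R).
  by rewrite dE; split => // n; exact: measurable_cst.
have := doob_weighted sF subF incF (ltr1n R 2) (measurable_cst _)
  (aeW mu (fun=> ltr01)) i1 v1 (fun _ _ => ltr01) mh h0 vh.
rewrite dE => H.
rewrite (_ : \int[mu]_x supe _ x = \int[mu]_x (supe (fun n x =>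
    ((h_ n x / cst 1 x) `^ 2)%R) x * (cst 1 x)%:E)); last first.
  apply: eq_integral => x _; rewrite mule1; congr ereal_sup.
  apply/seteqP; split => _ [n _ <-]; exists n => //=; congr _%:E.
    by rewrite divr1 powR_mulrn.
  by rewrite divr1 powR_mulrn.
rewrite (_ : \int[mu]_x (h x ^+ 2)%:E = \int[mu]_x (h x `^ 2 * `|cst 1 x|)%:E)//.
by apply: eq_integral => x _; rewrite /= normr1 mulr1 powR_mulrn.
Qed.

(** Beside the sparse factor [2^p * 2] and [C], two Doob constants appear: that of exponent 2 for
    the versions of [h], and that of exponent [p] for the integral of [h^2]. *)
Lemma maximal_norm_Bp (p : R) (u w : T -> R) (C : R) :
  (1 < p)%R -> weight mu u -> weight mu w ->
  mu.-integrable [set: T] (EFin \o dual_weight p w) ->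
  Bp_bound mu F p u w C -> maximal_norm mu F p w u <=
  ((2 `^ p * 2 * doob_cst p * (C * doob_cst 2)) `^ p^-1)%:E.
Proof.
move=> p1 wu ww int_s [C0 hC].
have p0 : (0 < p)%R by exact: lt_trans p1.
have D0 := doob_cst_ge0 p1; have D20 := @doob_cst_ge0 R 2 (ltr1n _ _).
pose sigma := dual_weight p w.
have s0 x : (0 <= sigma x)%R by exact: powR_ge0.
have ms : measurable_fun [set: T] sigma.
  by apply/measurable_EFinP; exact: measurable_int int_s.
have sp : {ae mu, forall x, (0 < sigma x)%R}.
  by apply: filterS ww.2 => x wx; exact: powR_gt0.
have [u_ [vu u_0 uE]] := weight_version sF subF wu.
have [s_ [vs s_gt0 sE]] := exists_gt0_version sF subF int_s s0 sp.
have ir := integrable_powR_half ms s0 int_s.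
have mr : measurable_fun [set: T] (fun x => (sigma x `^ 2^-1)%R).
  exact: (measurableT_comp (measurable_powR _)).
have rp : {ae mu, forall x, (0 < sigma x `^ 2^-1)%R}.
  by apply: filterS sp => x; exact: powR_gt0.
have [c_ [vc c_gt0 _]] := exists_gt0_version sF subF ir (fun x => powR_ge0 _ _) rp.
have [au _ _] := vu; have [as_ _ _] := vs; have [ac _ _] := vc.
apply: (maximal_norm_le sF subF p1 wu ww int_s).
  by apply: mulr_ge0; [apply: mulr_ge0 => //; exact: mulr_ge0|apply: mulr_ge0 => //; exact: ltW].
move=> phi phi_ mphi phi0 iphi vphi phiw.
have [aphi phi_0 _] := vphi.
have mw : measurable_fun [set: T] w by exact: measurable_weight ww.
pose xp n x : R := ((phi_ n x / s_ n x) `^ p)%R.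
have xp0 n x : (0 <= xp n x)%R by exact: powR_ge0.
have ax : adapted F xp.
  move=> n; apply: (measurableT_comp (measurable_powR p)).
  by apply: (@measurable_fun_div _ (TF n)); [exact: aphi|exact: as_|move=> x; exact: ltW].
have mxp n : measurable_fun [set: T] (xp n) by exact: (Fmeas_measurable sF subF (@ax n)).
have mc n : measurable_fun [set: T] (c_ n) by exact: (Fmeas_measurable sF subF (@ac n)).
(* [c_n] conditions [sigma^(1/2)]; by B_p and Jensen [u_n s_n^p <= C c_n^2]. *)
pose Z n x : R := (xp n x * c_ n x ^+ 2)%R.
have Z0 n x : (0 <= Z n x)%R by rewrite mulr_ge0// exprn_ge0// ltW.
have aZ : adapted F Z.
  by move=> n; apply: measurable_funM; [exact: ax|apply: measurable_funX; exact: ac].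
have mau : measurable_fun [set: T] (fun x => `|u x|%R).
  by apply: measurableT_comp => //; exact: measurable_weight wu.
have H := @integral_supe_powR_le _ _ _ _ _ sF subF incF _ _ mphi phi0 vphi p _ _ 1
  (fun=> C) (fun=> Z) p0 mau (fun x => normr_ge0 _) vu (fun=> ltW C0) (fun=> aZ) (fun=> Z0).
apply: le_trans (H _ _) _.
- by move=> j n x phi_x; rewrite /Z /xp phi_x mul0r powR0 ?gt_eqF// mul0r.
- move=> n.
  have us : {ae mu, forall x, cond_exp mu (F n) (EFin \o u) x = (u_ n x)%:E /\
      cond_exp mu (F n) (EFin \o sigma) x = (s_ n x)%:E}.
    by move: (uE n) (sE n); apply: filterS2 => x; split.
  move: (hC n) us (cond_exp_ln_le sF subF n int_s s0 sp vc c_gt0).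
  apply: filterS3 => x hx [ux sx] jx; rewrite big_ord1.
  move: hx; rewrite ux sx poweR_EFin -EFinM => hx.
  have {}hx : (u_ n x * s_ n x `^ p <= C * c_ n x ^+ 2)%R.
    rewrite -lee_fin; apply: le_trans hx _; rewrite EFinM lee_wpmul2l ?lee_fin ?(ltW C0)//.
    apply: (@le_trans _ _ (expeR (2 * ln (c_ n x))%:E)); first by rewrite lee_expeR.
    by rewrite /= lee_fin expRM_natl lnK// posrE.
  rewrite (powR_ratio _ p0 (phi_0 n x) (s_gt0 n x)) -/(xp n x).
  rewrite /Z [leRHS]mulrCA -[leLHS]mulrA ler_wpM2l//.
  by apply: le_trans hx; rewrite -(mulr_powRB1 (ltW (s_gt0 n x)) p0) mulrCA.
rewrite big_ord1.
have doob := doob_weighted sF subF incF p1 mw ww.2 int_s vs s_gt0 mphi phi0 vphi.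
rewrite -/xp -/sigma in doob.
set Iw := \int[mu]_x (phi x `^ p * `|w x|)%:E in doob phiw *.
have I0 : 0 <= Iw by apply: integral_ge0 => x _; rewrite lee_fin mulr_ge0 ?powR_ge0.
have S0 x : 0 <= supe xp x by exact: supe_ge0.
have mS : measurable_fun [set: T] (supe xp) by exact: measurable_supe.
have mES : measurable_fun [set: T] (fun x => supe xp x * (sigma x)%:E).
  by apply: emeasurable_funM => //; exact/measurable_EFinP.
(* The weighted Doob inequality makes the supremum times [sigma] integrable, and [sigma > 0] a.e.;
   hence [fine] loses nothing below, almost everywhere. *)
have Sfin : {ae mu, forall x, supe xp x \is a fin_num}.
  have iS : mu.-integrable [set: T] (fun x => supe xp x * (sigma x)%:E).
    apply/integrableP; split => //.
    under eq_integral do rewrite gee0_abs ?mule_ge0 ?lee_fin//.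
    by apply: le_lt_trans doob _; rewrite lte_mul_pinfty ?lee_fin.
  have := integrable_ae measurableT iS; move: sp; apply: filterS2 => x sx /(_ I).
  have := S0 x; case: (supe xp x) => // _.
  by rewrite gt0_mulye ?lte_fin.
pose q x : R := (fine (supe xp x) * sigma x)%R.
have q0 x : (0 <= q x)%R by rewrite mulr_ge0// fine_ge0.
have mq : measurable_fun [set: T] q.
  by apply: measurable_funM => //; apply: measurableT_comp => //; exact: fine_measurable.
have qS : \int[mu]_x (q x)%:E <= (doob_cst p)%:E * Iw.
  apply: le_trans doob; apply: ge0_le_integral => //.
  - by move=> x _; rewrite lee_fin.
  - exact/measurable_EFinP.
  - move=> x _; rewrite /q EFinM lee_wpmul2r ?lee_fin//.
    by have := S0 x; case: (supe xp x) => [r| |]//= _; rewrite leey.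
have iq : mu.-integrable [set: T] (EFin \o q).
  apply/integrableP; split; first exact/measurable_EFinP.
  rewrite (_ : \int[mu]_x _ = \int[mu]_x (q x)%:E); last first.
    by apply: eq_integral => x _ /=; rewrite ger0_norm.
  by apply: le_lt_trans qS _; rewrite lte_mul_pinfty ?lee_fin.
pose h x : R := (q x `^ 2^-1)%R.
have h0 x : (0 <= h x)%R by exact: powR_ge0.
have ih : mu.-integrable [set: T] (EFin \o h) by exact: integrable_powR_half.
have mh : measurable_fun [set: T] h by exact: (measurableT_comp (measurable_powR _)).
have [h_ [vh _]] := exists_version sF subF ih h0.
have [ah h_0 hE] := vh.
(* The left side conditions $x_n^{p/2}\sigma^{1/2}$, which is at most [h] almost everywhere. *)
have key n : {ae mu, forall x, (xp n x `^ 2^-1 * c_ n x)%:E <= (h_ n x)%:E}.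
  have ag : measurable_fun [set: TF n] (fun x : TF n => (xp n x `^ 2^-1 * c_ n x)%R).
    apply: measurable_funM; last exact: ac.
    by apply: (measurableT_comp (measurable_powR _)); exact: ax.
  apply: (ae_le_of_integral (sF n) (@subF n)
    (X := EFin \o (fun x => xp n x `^ 2^-1 * c_ n x)%R)).
  - exact/measurable_EFinP.
  - exact: ah.
  - move=> A k FA _; have mA := subF FA; rewrite hE//.
    pose X x : R := ((x \in A)%:R * xp n x `^ 2^-1)%R.
    have X0 x : (0 <= X x)%R by rewrite mulr_ge0 ?powR_ge0.
    have aX : measurable_fun [set: TF n] (X : TF n -> R).
      apply: measurable_funM; first by apply: Fmeas_natr; exact: (Fmeas_pred sF).
      by apply: (measurableT_comp (measurable_powR _)); exact: ax.
    rewrite (_ : \int[mu]_(x in A) _ = \int[mu]_x ((X x)%:E * (c_ n x)%:E)); last first.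
      rewrite integral_mkcond; apply: eq_integral => x _; rewrite patchE /X /=.
      by case: (x \in A); rewrite ?mul0r ?mul0e// mul1r.
    rewrite -(version_integralM sF subF vc mr (fun x => powR_ge0 _ _) aX X0).
    rewrite [leRHS]integral_mkcond; apply: ae_ge0_le_integral => //.
    + by move=> x _; rewrite mule_ge0 ?lee_fin ?powR_ge0.
    + apply: emeasurable_funM; apply/measurable_EFinP => //.
      exact: (Fmeas_measurable (n := n) sF subF).
    + by move=> x _; apply: erestrict_ge0 => y _; rewrite lee_fin.
    + exact/(measurable_restrictT _ mA)/measurable_funTS/measurable_EFinP.
    + apply: filterS Sfin => x Sx _; rewrite patchE /X.
      case: (x \in A); last by rewrite mul0r mul0e.
      rewrite mul1r -EFinM lee_fin -powRM// /h.
      apply: ge0_ler_powR; rewrite ?nnegrE ?invr_ge0 ?mulr_ge0 ?fine_ge0//.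
      by rewrite /q ler_wpM2r// -lee_fin fineK//; exact: le_supe.
have keyZ : {ae mu, forall x, supe Z x <= supe (fun n x => (h_ n x ^+ 2)%R) x}.
  have : {ae mu, forall x n, (xp n x `^ 2^-1 * c_ n x)%:E <= (h_ n x)%:E} by exact/ae_foralln.
  apply: filterS => x hx; apply: supe_le => n.
  apply: le_trans (le_supe (fun n x => (h_ n x ^+ 2)%R) n x); rewrite lee_fin.
  rewrite /Z -[X in (X * _ <= _)%R](powR_half_sqr (xp0 n x)) -exprMn.
  by rewrite ler_sqr ?nnegrE ?mulr_ge0 ?powR_ge0 ?(ltW (c_gt0 n x))// -lee_fin.
have ZI : \int[mu]_x supe Z x <= (doob_cst 2)%:E * ((doob_cst p)%:E * Iw).
  apply: (@le_trans _ _ (\int[mu]_x supe (fun n x => (h_ n x ^+ 2)%R) x)).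
    apply: ae_ge0_le_integral => //.
    - by move=> x _; exact: supe_ge0.
    - by apply: measurable_supe => n; exact: (Fmeas_measurable sF subF (@aZ n)).
    - by move=> x _; apply: supe_ge0; exact: exprn_ge0.
    - apply: measurable_supe => n; apply: measurable_funX.
      exact: (Fmeas_measurable sF subF (@ah n)).
    - by apply: filterS keyZ.
  apply: le_trans (doob_L2 mh h0 vh) _.
  apply: lee_wpmul2l; first by rewrite lee_fin.
  by under eq_integral do rewrite /h powR_half_sqr//.
have -> : (2 `^ p * 2 * doob_cst p * (C * doob_cst 2))%:E * Iw =
    (2 `^ p * 2)%:E * (C%:E * ((doob_cst 2)%:E * ((doob_cst p)%:E * Iw))).
  rewrite !muleA -!EFinM; congr (_%:E * _); ring.
apply: lee_wpmul2l; first by rewrite lee_fin mulr_ge0 ?powR_ge0.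
by apply: lee_wpmul2l => //; rewrite lee_fin ltW.
Qed.

End Bp_bound_theory.

(** * The three bounds *)

Section assembly.
Context (d : measure_display) (T : measurableType d) (R : realType).
Variables (mu : probability T R) (F : nat -> set (set T)).

Lemma maximal_norm_ge0 (p : R) (w u : T -> R) : 0 <= maximal_norm mu F p w u.
Proof. by apply: le_ereal_inf_tmp => _ [C [C0 _] <-]; rewrite lee_fin. Qed.

(** Raising to the power [p] and dividing by [c] turns the bound for each admissible constant into a
    lower bound for all of them; [c = 0] is settled by a single admissible constant. *)
Lemma le_inf_poweR (p c : R) (N : \bar R) (S : set R) : (0 < p)%R -> (0 <= c)%R ->
  0 <= N -> S !=set0 ->
  (forall C, S C -> (0 <= C)%R /\ N <= ((c * C) `^ p^-1)%:E) ->
  N <= (c `^ p^-1)%:E * ereal_inf [set C%:E | C in S] `^ p^-1.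
Proof.
move=> p0 c0 N0 [C1 SC1] NS.
have pV : (0 <= p^-1)%R by rewrite invr_ge0 ltW.
have inf0 : 0 <= ereal_inf [set C%:E | C in S].
  by apply: le_ereal_inf_tmp => _ [C /NS[C0 _] <-]; rewrite lee_fin.
move: c0 NS; rewrite le_eqVlt => /predU1P[<-|c0] NS.
  have [_] := NS C1 SC1; rewrite mul0r powR0; last by rewrite invr_eq0 gt_eqF.
  by move=> /le_trans; apply; rewrite mule_ge0 ?poweR_ge0// lee_fin powR_ge0.
rewrite -poweR_EFin -poweRM ?lee_fin ?(ltW c0)// -[leLHS](poweRKV p0 N0).
apply: le_poweR; rewrite ?poweR_ge0// -lee_pdivrMl//.
apply: le_ereal_inf_tmp => _ [C SC <-]; have [C0 NC] := NS C SC.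
have cC0 : 0 <= (c * C)%:E by rewrite lee_fin mulr_ge0// ltW.
rewrite lee_pdivrMl// -EFinM -[leRHS](poweRVK p0 cC0).
by apply: le_poweR; rewrite ?(ltW p0)// poweR_EFin.
Qed.

Lemma ae_le_Lnorm_infty (f : T -> \bar R) (K : \bar R) :
  Lnorm mu +oo f <= K -> {ae mu, forall x, `|f x| <= K}.
Proof.
have mT : 0 < mu setT by rewrite probability_setT lte01.
by rewrite unlock/= ifT// => /ess_supP.
Qed.

(** A null set cannot be the whole probability space. *)
Lemma ae_cst (P : Prop) : {ae mu, forall x : T, P} -> P.
Proof.
move=> [N [mN N0 PN]]; apply: contrapT => nP.
have NT : N = setT by apply/seteqP; split => // x _; exact: PN.
by move: N0; rewrite NT probability_setT => /eqP; rewrite onee_eq0.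
Qed.

Hypothesis fps : filtered_probability_space mu F.
Let sF := fps_sigma_algebra fps.
Let subF := fps_sub fps.
Let incF := fps_increasing fps.
Variables (p : R) (u w : T -> R).
Hypotheses (p1 : (1 < p)%R) (wu : weight mu u) (ww : weight mu w).
Hypothesis int_s : mu.-integrable [set: T] (EFin \o dual_weight p w).

Local Notation TF n := (g_sigma_algebraType (F n)).
Local Notation sigma := (dual_weight p w).

Let p0 : (0 < p)%R. Proof. exact: lt_trans p1. Qed.
Let s0 x : (0 <= sigma x)%R. Proof. exact: powR_ge0. Qed.
Let sp : {ae mu, forall x, (0 < sigma x)%R}.
Proof. by apply: filterS ww.2 => x wx; exact: powR_gt0. Qed.

Let FT n : F n setT.
Proof. by rewrite -(sub_measurableE (sF n)); exact: measurableT. Qed.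

Lemma Ap_const_ge0 (v : T -> R) : 0 <= Ap_const mu F p v w.
Proof. by apply: le_trans (Lnorm_ge0 _ _ _) (ereal_sup_ubound _); exists 0%N. Qed.

Lemma mixed_const_ge0 : 0 <= mixed_const mu F p w.
Proof.
by apply: le_trans (poweR_ge0 _ _) (ereal_sup_ubound _); exists 0%N.
Qed.

Lemma ae_Ap_const (v : T -> R) (v_ s_ : nat -> T -> R) n :
  in_Ap mu F p v w ->
  (forall n, {ae mu, forall x, cond_exp mu (F n) (EFin \o v) x = (v_ n x)%:E}) ->
  (forall n, {ae mu, forall x, cond_exp mu (F n) (EFin \o sigma) x = (s_ n x)%:E}) ->
  {ae mu, forall x, (v_ n x * s_ n x `^ (p - 1) <= fine (Ap_const mu F p v w))%R}.
Proof.
move=> Ap vE sE.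
have fA : Ap_const mu F p v w \is a fin_num by rewrite ge0_fin_numE ?Ap_const_ge0.
have : Lnorm mu +oo (fun x => cond_exp mu (F n) (EFin \o v) x *
    cond_exp mu (F n) (EFin \o sigma) x `^ (p - 1)) <= Ap_const mu F p v w.
  by apply: ereal_sup_ubound; exists n.
move=> /ae_le_Lnorm_infty; move: (vE n) (sE n); apply: filterS3 => x -> ->.
rewrite -lee_fin fineK//; apply: le_trans.
by rewrite poweR_EFin -EFinM; exact: lee_abs.
Qed.

(** The sliced bound with one slice, the whole space. *)
Lemma maximal_norm_ApAinfty (C : R) : in_Ap mu F p u w ->
  Ainfty_bound mu F sigma C -> maximal_norm mu F p w u <=
  ((2 `^ p * 2 * doob_cst p * (fine (Ap_const mu F p u w) * C)) `^ p^-1)%:E.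
Proof.
move=> Ap [C0 hC].
have [u_ [vu _ uE]] := weight_version sF subF wu.
have [s_ [vs s_gt0 sE]] := exists_gt0_version sF subF int_s s0 sp.
have := @maximal_norm_sliced _ _ _ _ _ sF subF incF _ _ _ p1 wu ww int_s _ _ vu vs
  s_gt0 sE 1 (fun=> fine (Ap_const mu F p u w)) (fun=> C) (fun _ _ => setT).
rewrite big_ord1; apply => //.
- by move=> _; rewrite fine_ge0// Ap_const_ge0.
- by move=> _; exact: ltW.
- move=> _ n B FB _.
  by apply: (tail_le_Ainfty sF subF int_s vs sE (ltW C0) (hC n)).
- move=> n; apply: filterS (ae_Ap_const n Ap uE sE) => x h.
  by rewrite big_ord1 in_setT mulr1.
Qed.

(** Almost everywhere $1\le w_0 s_0^{p-1}\le[w]_{A_p}$, and an inequality between constants that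
    holds a.e. holds. *)
Lemma Ap_const_ge1 : in_Ap mu F p w w -> (1 <= fine (Ap_const mu F p w w))%R.
Proof.
move=> Ap; have [w_ [vw w_0 wE]] := weight_version sF subF ww.
have [s_ [vs s_gt0 sE]] := exists_gt0_version sF subF int_s s0 sp.
have h1 := version_Ap_ge1 sF subF 0 p1 ww int_s vw w_0 vs s_gt0.
have h2 := ae_Ap_const 0 Ap wE sE.
by apply: ae_cst; move: h1 h2; apply: filterS2 => x; exact: le_trans.
Qed.

(* Slices of [[1, [w]_{A_p}]] along powers of two. *)
Lemma maximal_norm_mixed (m : R) : in_Ap mu F p w w ->
  mixed_const mu F p w = m%:E -> maximal_norm mu F p w w <=
  ((2 `^ p * 2 * doob_cst p *
    (2 * m `^ p * (1 + ln (fine (Ap_const mu F p w w)) / ln 2))) `^ p^-1)%:E.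
Proof.
move=> Ap mE; set r := fine (Ap_const mu F p w w).
have r1 : (1 <= r)%R by exact: Ap_const_ge1.
have r0 : (0 < r)%R by exact: lt_le_trans r1.
have l2 : (0 < ln (2 : R))%R by rewrite ln_gt0// ltr1n.
have [w_ [vw w_0 wE]] := weight_version sF subF ww.
have [s_ [vs s_gt0 sE]] := exists_gt0_version sF subF int_s s0 sp.
have [aw _ _] := vw; have [as_ _ _] := vs.
pose v n x : R := (w_ n x * s_ n x `^ (p - 1))%R.
have av : adapted F v.
  move=> n; apply: measurable_funM; first exact: aw.
  by apply: (measurableT_comp (measurable_powR _)); exact: as_.
have v0 n x : (0 < v n x)%R by rewrite mulr_gt0 ?powR_gt0.
(* The slices [j < J] cover [[1, r]], and [J] is at most [1 + log_2 r]. *)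
pose J := (truncn (ln r / ln 2)%R).+1.
pose Q j n := [set x | (2 ^+ j <= v n x)%R && (v n x < 2 ^+ j.+1)%R].
have FQ j n : F n (Q j n).
  apply: (Fmeas_set sF); apply: measurable_and.
  - by apply: measurable_fun_ler => //; exact: av.
  - by apply: measurable_fun_ltr => //; exact: av.
have m0 : (0 <= m)%R by rewrite -lee_fin -mE mixed_const_ge0.
have M0 : (0 <= m `^ p)%R by exact: powR_ge0.
(* On slice [j] the A_p quantity is at least [2^j], while its product with the conditional
   expectation of the tail quotient is at most [m^p]. *)
have tail j n B : F n B -> B `<=` Q j n ->
    \int[mu]_(x in B) tail_maximal mu F n sigma x <=
    ((2 ^+ j)^-1 * m `^ p)%:E * \int[mu]_(x in B) (sigma x)%:E.
  move=> FB BQ; have j0 : (0 < 2 ^+ j :> R)%R by rewrite exprn_gt0.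
  apply: (tail_le_ratio sF subF int_s vs s_gt0 sE (fps_complete fps)) => //.
    by rewrite mulr_ge0// invr_ge0 ltW.
  set e := cond_exp mu (F n) _.
  have : Lnorm mu +oo (fun x => cond_exp mu (F n) (EFin \o sigma) x `^ (p - 1) *
      cond_exp mu (F n) (EFin \o w) x * e x) `^ p^-1 <= m%:E.
    by rewrite -mE; apply: ereal_sup_ubound; exists n.
  move=> /(le_poweR (ltW p0) (poweR_ge0 _ _)).
  rewrite poweRVK ?Lnorm_ge0// poweR_EFin => /ae_le_Lnorm_infty.
  move: (wE n) (sE n); apply: filterS3 => x -> -> h Bx.
  have /andP[vj _] := BQ x Bx.
  have [e0|/ltW e0] := leP (e x) 0.
    by apply: le_trans e0 _; rewrite lee_fin mulr_ge0// invr_ge0 ltW.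
  rewrite EFinM lee_pdivlMl//; apply: le_trans (le_trans (lee_abs _) h).
  by rewrite poweR_EFin -EFinM lee_wpmul2r// lee_fin mulrC.
have L0 : (0 <= ln r / ln 2)%R by apply: divr_ge0; [exact: ln_ge0|exact: ltW].
have JE : (\sum_(j < J) 2 ^+ j.+1 * ((2 ^+ j)^-1 * m `^ p) <=
    2 * m `^ p * (1 + ln r / ln 2))%R.
  rewrite (eq_bigr (fun=> 2 * m `^ p)%R); last first.
    by move=> j _; rewrite exprS -!mulrA mulVKf// gt_eqF// exprn_gt0.
  rewrite sumr_const card_ord -[leLHS]mulr_natr ler_wpM2l ?mulr_ge0//.
  by rewrite /J -natr1 addrC lerD2l truncn_le.
have := @maximal_norm_sliced _ _ _ _ _ sF subF incF _ _ _ p1 ww ww int_s _ _ vw vs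
  s_gt0 sE J (fun j => 2 ^+ j.+1)%R (fun j => (2 ^+ j)^-1 * m `^ p)%R Q.
move=> H; apply: le_trans (H _ _ FQ tail _) _.
- by move=> j; exact: exprn_ge0.
- by move=> j; rewrite mulr_ge0// invr_ge0 exprn_ge0.
- move=> n; move: (version_Ap_ge1 sF subF n p1 ww int_s vw w_0 vs s_gt0)
    (ae_Ap_const n Ap wE sE); apply: filterS2 => x; rewrite -/(v n x) -/r => v1 vr.
  have lv0 : (0 <= ln (v n x) / ln 2)%R by apply: divr_ge0; [exact: ln_ge0|exact: ltW].
  (* The integer part of [log_2 v] is the index of the slice containing [v], and [v <= r] gives
     [j < J]. *)
  pose j := truncn (ln (v n x) / ln 2)%R.
  have jJ : (j < J)%N.
    rewrite ltnS; apply: le_truncn; rewrite ler_pM2r ?invr_gt0//.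
    by rewrite ler_ln ?posrE.
  have /andP[j1 j2] := truncn_itv lv0.
  have vQ : x \in Q j n.
    apply/mem_set/andP; split.
      rewrite -ler_ln ?posrE ?exprn_gt0// lnXn// -[leLHS]mulr_natl -ler_pdivlMr//.
    rewrite -ltr_ln ?posrE ?exprn_gt0// lnXn// -[ltRHS]mulr_natl -ltr_pdivrMr//.
  rewrite (bigD1 (Ordinal jJ))//= vQ mulr1 -[leLHS]addr0 lerD//.
    by move: vQ => /set_mem/andP[_ /ltW].
  by apply: sumr_ge0 => i _; rewrite mulr_ge0// exprn_ge0.
have D0 := doob_cst_ge0 p1.
have D20 : (0 <= 2 `^ p * 2 * doob_cst p)%R.
  by apply: mulr_ge0 => //; apply: mulr_ge0.
have S0 : (0 <= \sum_(j < J) 2 ^+ j.+1 * ((2 ^+ j)^-1 * m `^ p))%R.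
  by apply: sumr_ge0 => j _; rewrite mulr_ge0 ?exprn_ge0// mulr_ge0// invr_ge0 exprn_ge0.
rewrite lee_fin; apply: ge0_ler_powR; rewrite ?nnegrE ?invr_ge0 ?(ltW p0)//.
- exact: mulr_ge0.
- by apply: mulr_ge0 => //; apply: le_trans JE.
- exact: ler_wpM2l.
Qed.

End assembly.

Theorem theorem1p13 (R : realType) (p : R) (p_gt1 : (1 < p)%R) :
  exists C : R,
  forall (d : measure_display) (T : measurableType d) (mu : probability T R)
    (F : nat -> set (set T)) (u w : T -> R),
  filtered_probability_space mu F ->
  weight mu u -> weight mu w ->
  mu.-integrable [set: T] (EFin \o dual_weight p w) ->
  [/\ in_Bp mu F p u w ->
        maximal_norm mu F p w u <= C%:E * Bp_const mu F p u w `^ p^-1,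
      in_Ap mu F p u w -> in_Ainfty mu F (dual_weight p w) ->
        maximal_norm mu F p w u <=
          C%:E * Ap_const mu F p u w `^ p^-1 *
          Ainfty_const mu F (dual_weight p w) `^ p^-1
    & in_Ap mu F p w w ->
        maximal_norm mu F p w w <=
          C%:E * mixed_const mu F p w *
          ((1 + ln (fine (Ap_const mu F p w w)) / ln 2) `^ p^-1)%R%:E].
Proof.
have p0 : (0 < p)%R by exact: lt_trans p_gt1.
have pV : (0 <= p^-1)%R by rewrite invr_ge0 ltW.
have D20 := @doob_cst_ge0 R 2 (ltr1n _ _).
have Dp : (0 < doob_cst p)%R.
  have q0 : (0 < p / (p - 1))%R by rewrite divr_gt0// subr_gt0.
  by apply: mulr_gt0 => //; apply: mulr_gt0 => //; apply: powR_gt0; exact: mulr_gt0.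
pose a : R := (2 `^ p * 2 * doob_cst p)%R.
have a0 : (0 < a)%R by apply: mulr_gt0 => //; apply: mulr_gt0 => //; exact: powR_gt0.
(* Beside the common factor [a] the three bounds need [doob_cst 2], 1 and 2 respectively;
   [2 * (1 + doob_cst 2)] dominates each. *)
pose c : R := (a * (2 * (1 + doob_cst 2)))%R.
have c0 : (0 < c)%R by apply: mulr_gt0 => //; lra.
have le_c x y : (0 <= x)%R -> (x <= 2 * (1 + doob_cst 2) * y)%R ->
    ((a * x) `^ p^-1 <= (c * y) `^ p^-1)%R.
  move=> x0 xy; have axy : (a * x <= c * y)%R by rewrite /c -mulrA ler_pM2l.
  have ax0 : (0 <= a * x)%R by rewrite mulr_ge0// ltW.
  by apply: ge0_ler_powR; rewrite ?nnegrE// (le_trans ax0).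
exists (c `^ p^-1)%R => d T mu F u w fps wu ww int_s.
have sF := fps_sigma_algebra fps.
have subF := fps_sub fps.
have incF := fps_increasing fps.
split.
- move=> Bp; apply: le_inf_poweR => //; [exact: ltW|exact: maximal_norm_ge0|].
  move=> C hC; have C0 := hC.1; split; first exact: ltW.
  apply: le_trans (maximal_norm_Bp sF subF incF p_gt1 wu ww int_s hC) _.
  rewrite lee_fin; apply: le_c; first by rewrite mulr_ge0// ltW.
  have := mulr_ge0 (ltW C0) D20; lra.
- move=> Ap Ainf.
  have A0 := Ap_const_ge0 mu F p w u.
  have fA : Ap_const mu F p u w \is a fin_num by rewrite ge0_fin_numE.
  have {}A0 : (0 <= fine (Ap_const mu F p u w))%R by exact: fine_ge0.
  (* The finite A_p factor is merged into the constant, so that only the infimum over admissible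
     $A^*_\infty$ constants remains. *)
  rewrite -(fineK fA) poweR_EFin -EFinM -powRM ?(ltW c0)//.
  apply: le_inf_poweR => //; [by rewrite mulr_ge0// ltW|exact: maximal_norm_ge0|].
  move=> C hC; have C0 := hC.1; split; first exact: ltW.
  apply: le_trans (maximal_norm_ApAinfty fps p_gt1 wu ww int_s Ap hC) _.
  rewrite lee_fin -(mulrA c); have AC0 := mulr_ge0 A0 (ltW C0).
  by apply: le_c => //; have := mulr_ge0 AC0 D20; lra.
- move=> Ap; have r1 := Ap_const_ge1 fps p_gt1 ww int_s Ap.
  have l0 : (0 <= ln (fine (Ap_const mu F p w w)) / ln 2)%R.
    by apply: divr_ge0; [exact: ln_ge0|rewrite ln_ge0// ler1n].
  set l := (_ / ln 2)%R in l0 *.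
  have := mixed_const_ge0 mu F p w; case mE : (mixed_const mu F p w) => [m| |]// m0.
    rewrite lee_fin in m0.
    apply: le_trans (maximal_norm_mixed fps p_gt1 ww int_s Ap mE) _.
    rewrite -/l -!EFinM lee_fin.
    have mp0 : (0 <= m `^ p)%R by exact: powR_ge0.
    have ml0 : (0 <= m `^ p * (1 + l))%R by rewrite mulr_ge0// addr_ge0.
    apply: (@le_trans _ _ ((c * (m `^ p * (1 + l))) `^ p^-1)%R).
      apply: le_c; first by rewrite mulr_ge0 ?addr_ge0// mulr_ge0.
      by have := mulr_ge0 ml0 D20; lra.
    rewrite powRM ?(ltW c0)// powRM ?addr_ge0// -[((m `^ p) `^ _)%R]powRrM.
    by rewrite mulfV ?gt_eqF// powRr1// mulrA.
  (* An infinite mixed constant makes the right side infinite, since [c] and the logarithmic factor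
     are positive. *)
  rewrite gt0_muley ?lte_fin ?powR_gt0// gt0_mulye ?leey// lte_fin powR_gt0//.
  lra.
Qed.
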